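(* Let $h\in\mathcal F$ be the harmonic function with boundary values $h(q_0)=1$, $h(q_1)=h(q_2)=0$, and let $\omega:=\partial h$. Let $u_L\in\mathcal F_L$ and $u_R\in\mathcal F_R$, and define $u:=\mathds 1_{K_L}u_L+\mathds 1_{K_R}u_R$. Then $u\in D_{\nu_h}(\partial^\perp_{V_0})$.
   Context: Gasket. Let $r=3/5$, $q_0=(1/2,\sqrt3/2)$, $q_1=(0,0)$, $q_2=(1,0)$, $F_i(x)=\frac12(x-q_i)+q_i$, and let $K\subset\mathbb R^2$ be the Sierpinski gasket (attractor of $F_0,F_1,F_2$). For a word $w=w_1\cdots w_n$ over $\{0,1,2\}$ (length $|w|=n$, empty word allowed with $F_\emptyset=\mathrm{Id}$) put $F_w=F_{w_1}\circ\dots\circ F_{w_n}$, $K_w=F_w(K)$. $V_0=\{q_0,q_1,q_2\}$, $V_n=\bigcup_{|w|=n}F_w(V_0)$. Write $p\sim_nq$ if $p\ne q$ in $V_n$ lie in a common $K_w$, $|w|=n$. $\mathcal E(u,v)=\lim_m r^{-m}\sum_{p\sim_mq}(u(p)-u(q))(v(p)-v(q))$ (each edge once), $\mathcal E(u)=\mathcal E(u,u)$, $\mathcal F$ is the set of continuous $u:K\to\mathbb R$ for which these sums with $v=u$ are bounded in $m$, $\mathcal F_{V_0}=\{u\in\mathcal F: u|_{V_0}=0\}$. $h\in\mathcal F$ is harmonic if $\mathcal E(h,\varphi)=0$ for all $\varphi\in\mathcal F_{V_0}$. The energy measure $\nu_{u,v}$ is the unique finite signed Borel measure with $\nu_{u,v}(K_w)=r^{-|w|}\mathcal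 E(u\circ F_w,v\circ F_w)$ for all $w$; $\nu_h=\nu_{h,h}$ (non-atomic). For $u$ with $u\circ F_w\in\mathcal F$ put $\mathcal E_{K_w}(u)=r^{-|w|}\mathcal E(u\circ F_w)$. Halves. $W_L=\{1,01,001,0001,\dots\}$, $W_R=\{2,02,002,0002,\dots\}$, $K_L=\bigcup_{w\in W_L}K_w$, $K_R=\bigcup_{w\in W_R}K_w$, $\mathcal F_L=\{u\in C(K_L):\sum_{w\in W_L}\mathcal E_{K_w}(u)<\infty\}$, $\mathcal F_R=\{u\in C(K_R):\sum_{w\in W_R}\mathcal E_{K_w}(u)<\infty\}$ (finiteness includes $u\circ F_w\in\mathcal F$ for each such $w$). One-forms. $\mathcal H$ is the Hilbert space obtained from finite sums of symbols $f\partial u$ ($f\in C(K)$, $u\in\mathcal F$) by quotienting and completing with respect to the bilinear extension of $\langle f\partial u,g\partial v\rangle_{\mathcal H}=\int_Kfg\,d\nu_{u,v}$; bounded Borel functions act on $\mathcal H$ by multiplication; $\partial:\mathcal F\to\mathcal H$, $\partial u=1\,\partial u$. The multiplication extends to an isometry $L^2(K,\nu_h)\ni f\mapsto f\omega=f\partial h\in\mathcal H$, which is an isomorphism here (nonconstant harmonic functions are minimal energy-dominant). $D_{\nu_h}(\partial^\perp_{V_0})$ is the set of $f\in L^2(K,\nu_h)$ for which there is $g\in L^2(K,\nu_h)$ with $\langle f\omega,\partial\varphi\rangle_{\mathcal H}=(g,\varphi)_{L^2(K,\nu_h)}$ for all $\varphi\in\mathcal F_{V_0}$; then $\partial^\perp_{V_0}f=-g$.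 Here $u$ is regarded as a $\nu_h$-equivalence class ($K_L\cap K_R$ is countable, hence $\nu_h$-null). *)

(* Defs.v *)
From HB Require Import structures.
From mathcomp Require Import all_boot all_order all_algebra.
From mathcomp Require Import all_classical all_reals all_analysis.

Set Implicit Arguments.
Unset Strict Implicit.
Unset Printing Implicit Defensive.

Import Order.TTheory GRing.Theory Num.Theory.
Import numFieldNormedType.Exports.

Local Open Scope classical_set_scope.
Local Open Scope ring_scope.

(* The product R * R carries its product topology and product
   sigma-algebra (which is the Borel one).  Functions on the gasket, or on a
   subset of it, are represented by functions on the whole plane; only their
   values on that subset are used. *)

Notation plane R := (R * R)%type.

Section gasket.
Variable R : realType.
Implicit Types (w : seq 'I_3) (u v f g h : plane R -> R).

Definition q (i : 'I_3) : plane R :=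
  match val i with
  | 0%N => (2^-1, Num.sqrt 3 / 2)
  | 1%N => (0, 0)
  | _ => (1, 0)
  end.

Definition F_ (i : 'I_3) (x : plane R) : plane R := (2^-1 : R) *: (x - q i) + q i.

Definition Fw w : plane R -> plane R := foldr (fun i G => F_ i \o G) idfun w.

Definition is_attractor (K : set (plane R)) :=
  [/\ K !=set0, compact K & K = \bigcup_i (F_ i @` K)].

(* Such a set exists and is unique (Hutchinson). *)
Definition gasket : set (plane R) := xget set0 is_attractor.

Definition cell w : set (plane R) := Fw w @` gasket.

Definition V0 : set (plane R) := range q.

Definition V_ n : set (plane R) :=
  \bigcup_(w in [set w | size w = n]) (Fw w @` V0).

(* The relation ~_n as a (finite) set of ordered pairs. *)
Definition adj n : set (plane R * plane R) :=
  [set e | [/\ V_ n e.1, V_ n e.2, e.1 <> e.2 &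
    exists w, [/\ size w = n, cell w e.1 & cell w e.2]]].

Definition rfac : R := 3 / 5.

(* Every edge occurs twice in [adj n], hence the factor 1/2. *)
Definition energy_at n u v : R :=
  rfac ^- n * (2^-1 * \sum_(e \in adj n) (u e.1 - u e.2) * (v e.1 - v e.2)).

Definition energy u v : R := lim (energy_at n u v @[n --> \oo]).

Definition CK : set (plane R -> R) := [set f | {within gasket, continuous f}].

Definition domF : set (plane R -> R) :=
  [set u | CK u /\ exists M, forall n, energy_at n u u <= M].

Definition domF0 : set (plane R -> R) :=
  [set u | domF u /\ forall p, V0 p -> u p = 0].

Definition is_harmonic h :=
  domF h /\ forall phi, domF0 phi -> energy h phi = 0.

Definition cell_energy w u v : R :=
  rfac ^- size w * energy (u \o Fw w) (v \o Fw w).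

(* [W_ 1] is W_L and [W_ 2] is W_R; likewise for [half_gasket] and [half_dom]. *)
Definition W_ (i : 'I_3) : set (seq 'I_3) :=
  [set rcons (nseq n ord0) i | n in [set: nat]].

Definition half_gasket (i : 'I_3) : set (plane R) := \bigcup_(w in W_ i) cell w.

Definition half_dom (i : 'I_3) : set (plane R -> R) :=
  [set u | [/\ {within half_gasket i, continuous u},
    forall w, W_ i w -> domF (u \o Fw w) &
    (\esum_(w in W_ i) (cell_energy w u u)%:E < +oo)%E]].

(* Finite signed Borel measures on the gasket are charges on the plane that
   vanish off the gasket. *)
Definition is_energy_measure u v (nu : {charge set (plane R) -> \bar R}) :=
  (forall A, measurable A -> A `&` gasket = set0 -> nu A = 0%E) /\
  (forall w, nu (cell w) = (cell_energy w u v)%:E).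

End gasket.

Section charge_integral.
Context d (T : measurableType d) (R : realType).
Variable nu : {charge set T -> \bar R}.

Definition hahn_pos : set T := sval (cid (Hahn_decomposition nu)).

Definition hahn_neg : set T := sval (cid (svalP (cid (Hahn_decomposition nu)))).

Definition hahnP : hahn_decomposition nu hahn_pos hahn_neg :=
  svalP (cid (svalP (cid (Hahn_decomposition nu)))).

Definition charge_integral (D : set T) (f : T -> R) : R :=
  \int[jordan_pos hahnP]_(x in D) f x - \int[jordan_neg hahnP]_(x in D) f x.

End charge_integral.

Section one_forms.
Variable R : realType.
Variable nu : (plane R -> R) -> (plane R -> R) -> {charge set (plane R) -> \bar R}.

(* A list of pairs (f, u) is the finite sum of the symbols f d u; scalars are
   absorbed in the coefficient f. *)
Definition formal_sum :=
  seq ({f : plane R -> R | CK f} * {u : plane R -> R | domF u}).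

Definition fsum_ip (a b : formal_sum) : R :=
  \sum_(s <- a) \sum_(t <- b)
    charge_integral (nu (sval s.2) (sval t.2)) (@gasket R)
      (fun x => sval s.1 x * sval t.1 x).

(* The squared seminorm of a - b, expanded. *)
Definition fsum_dist2 (a b : formal_sum) : R :=
  fsum_ip a a - fsum_ip a b - fsum_ip b a + fsum_ip b b.

Definition fsum_cauchy (a : nat -> formal_sum) :=
  forall e : R, 0 < e -> exists N, forall m n,
    (N <= m)%N -> (N <= n)%N -> fsum_dist2 (a m) (a n) < e.

(* The Hilbert space of one-forms: a vector of the completed quotient is given
   by a Cauchy sequence of formal sums, and two sequences x, y give the same
   vector when [form_dist2 x y = 0]. *)
Definition one_form := {a : nat -> formal_sum | fsum_cauchy a}.

Definition form_ip (x y : one_form) : R :=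
  lim (fsum_ip (sval x n) (sval y n) @[n --> \oo]).

Definition form_dist2 (x y : one_form) : R :=
  form_ip x x - form_ip x y - form_ip y x + form_ip y y.

Lemma fsum_cauchy_cst (a : formal_sum) : fsum_cauchy (fun=> a).
Proof.
by move=> e e0; exists 0%N => m n _ _; rewrite /fsum_dist2 subrr sub0r addNr.
Qed.

Definition form_of_fsum (a : formal_sum) : one_form :=
  exist _ (fun=> a) (fsum_cauchy_cst a).

Lemma CK1 : CK (fun=> 1 : R).
Proof. by move=> x; exact: cst_continuous. Qed.

(* f d u and d u = 1 d u *)
Definition fdu (f u : plane R -> R) (fC : CK f) (uF : domF u) : one_form :=
  form_of_fsum [:: (exist _ f fC, exist _ u uF)].

Definition du (u : plane R -> R) (uF : domF u) : one_form := fdu CK1 uF.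

Section divergence.
Variables (h : plane R -> R) (hF : domF h).
Variable nuh : {finite_measure set (plane R) -> \bar R}.

(* [x] is f omega with omega = d h, i.e. the image of f in L^2(nuh) under the
   isometry that extends multiplication of omega by continuous functions. *)
Definition is_mul_omega (f : plane R -> R) (x : one_form) :=
  exists (f_ : nat -> plane R -> R) (fC : forall n, CK (f_ n)),
    ((\int[nuh]_(z in @gasket R) ((f_ n z - f z) ^+ 2)%:E)%E @[n --> \oo]
       --> 0%E) /\
    (form_dist2 (fdu (fC n) hF) x @[n --> \oo] --> 0).

(* The domain of the operator -(d restricted to F_{V_0})^*, on L^2(nuh). *)
Definition dom_divergence : set (plane R -> R) :=
  [set f | f \in Lfun nuh 2%:E /\
    exists2 g : plane R -> R, g \in Lfun nuh 2%:E &
    exists x : one_form, is_mul_omega f x /\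
      forall phi (phiF : domF0 phi),
        form_ip x (du (proj1 phiF)) = \int[nuh]_(z in @gasket R) (g z * phi z)].

End divergence.
End one_forms.

(* Main.v *)
Require Import Defs.
From HB Require Import structures.
From mathcomp Require Import all_boot all_order all_algebra.
From mathcomp Require Import all_classical all_reals all_analysis.
From mathcomp Require Import measurable_realfun.
From mathcomp Require Import ring lra.

Set Implicit Arguments.
Unset Strict Implicit.
Unset Printing Implicit Defensive.

Import Order.TTheory GRing.Theory Num.Theory.
Import numFieldNormedType.Exports.

Local Open Scope classical_set_scope.
Local Open Scope ring_scope.

(* By the Leibniz rule nu_{h,u phi} = u nu_{h,phi} + phi nu_{h,u}, on every cell of
   K_L or K_R the integral of u against nu_{h,phi} is a boundary term minus the
   integral of phi against nu_{h,u}.  Since h is symmetric, its normal derivative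
   at the vertices on the axis of symmetry vanishes, so the boundary terms of
   consecutive cells telescope; they tend to 0 because phi(q_0) = 0 and u is
   bounded.  By Cauchy-Schwarz the remaining functional of phi is bounded by the
   L^2(nu_h) norm of phi, and the Riesz representation theorem gives g.

   Energy measures are only used through their values on cells: for the harmonic
   h these are r^{-n} E_0(h o F_w, phi o F_w), where E_0 is the energy on V_0, so
   integrals against nu_{h,phi} are limits of Riemann sums over edges, and the
   Leibniz rule and the Cauchy-Schwarz inequality are applied to these sums.
   The jump of u across the axis is harmless since nu_h has no atoms. *)

(** * Words and barycentric coordinates *)

(** Since [u] may jump across the axis and at q_0, the form u dh is given by a Cauchy sequence f_n
    dh, where f_n is [u] times a continuous cutoff vanishing on the axis. The axis meets the gasket
    in countably many points, so f_n tends to [u] almost everywhere, and bounded convergence applies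
    once [u] is bounded. Continuity does not give this bound, because both halves miss their limit
    point q_0; finite energy does, through an estimate of the oscillation on each cell by its
    energy. Harmonicity is given in weak form. An explicit extension of the boundary values,
    together with uniqueness, turns it into the rule with weights 2/5, 2/5, 1/5. This rule contracts
    oscillations by exactly r, which cancels the factor r^{-n} in nu_{h,phi}(K_w): small cells have
    small charge, so no charge has an atom. Cauchy-Schwarz is used as 2|st| <= s^2 + t^2, which adds
    up over cells without square roots. The outcome 2|l(phi)| <= |phi|^2 + C holds on a linear
    space, so scaling phi recovers a norm bound, and it is the form that the minimisation behind
    Riesz representation needs. *)

Lemma ord3P (P : 'I_3 -> Prop) : P ord0 -> P 1 -> P 2 -> forall i, P i.
Proof.
move=> P0 P1 P2 [[|[|[|//]]] lt_i3].
- by rewrite (_ : Ordinal _ = ord0) //; exact: val_inj.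
- by rewrite (_ : Ordinal _ = 1) //; exact: val_inj.
- by rewrite (_ : Ordinal _ = 2) //; exact: val_inj.
Qed.

Lemma sum3 (V : nmodType) (f : 'I_3 -> V) :
  \sum_(i < 3) f i = f ord0 + f 1 + f 2.
Proof.
rewrite !big_ord_recl big_ord0 addr0 addrA.
by congr (_ + f _ + f _); exact: val_inj.
Qed.

Fixpoint words n : seq (seq 'I_3) :=
  if n is m.+1 then [seq i :: w | i <- enum 'I_3, w <- words m] else [:: [::]].

Lemma mem_words n w : (w \in words n) = (size w == n).
Proof.
elim: n w => [|n IH] [|i w] //=.
- by apply/negP => /allpairsP[[? ?]] [].
- apply/allpairsP/idP => [[[j v] /= [_ vn [_ ->]]]|wn].
    by rewrite eqSS -IH.
  by exists (i, w); rewrite /= mem_enum IH.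
Qed.

Lemma uniq_words n : uniq (words n).
Proof.
elim: n => //= n IH; apply: allpairs_uniq => //; first exact: enum_uniq.
by move=> [i w] [j v] _ _ /= [-> ->].
Qed.

Lemma sum_words_recl (V : nmodType) n (f : seq 'I_3 -> V) :
  \sum_(w <- words n.+1) f w = \sum_(i < 3) \sum_(w <- words n) f (i :: w).
Proof. by rewrite /= big_allpairs_dep big_enum. Qed.

Lemma sum_words_cat (V : nmodType) m n (f : seq 'I_3 -> V) :
  \sum_(w <- words (m + n)) f w =
  \sum_(w <- words m) \sum_(v <- words n) f (w ++ v).
Proof.
elim: m f => [|m IH] f; first by rewrite big_seq1.
by rewrite addSn !sum_words_recl; apply: eq_bigr => i _; rewrite IH.
Qed.

Section bary.
Variable R : realType.
Implicit Types (x y : plane R) (w v : seq 'I_3).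

(** In the barycentric coordinates of q_0, q_1, q_2 the map [F_ j] halves everything and adds 1/2 to
    the j-th entry, so incidences between cells become linear inequalities free of the square
    root. *)
Definition bary (i : 'I_3) x : R :=
  match val i with
  | 0%N => 2 * x.2 / Num.sqrt 3
  | 1%N => 1 - x.1 - x.2 / Num.sqrt 3
  | _ => x.1 - x.2 / Num.sqrt 3
  end.

Lemma bary_q i j : bary i (q R j) = (i == j)%:R.
Proof.
have s0 : Num.sqrt 3 != 0 :> R by rewrite gt_eqF // sqrtr_gt0.
by elim/ord3P: i; elim/ord3P: j; rewrite /bary /q /= ?mul0r ?mulr0 ?mul0r; field.
Qed.

Lemma F_E i x : F_ i x = (2^-1 * (x.1 - (q R i).1) + (q R i).1,
                          2^-1 * (x.2 - (q R i).2) + (q R i).2).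
Proof. by []. Qed.

Lemma bary_F i j x : bary i (F_ j x) = (bary i x + (i == j)%:R) / 2.
Proof.
have s0 : Num.sqrt 3 != 0 :> R by rewrite gt_eqF // sqrtr_gt0.
by rewrite F_E; elim/ord3P: i; elim/ord3P: j; rewrite /bary /q /=; field.
Qed.

Lemma sum_bary x : bary ord0 x + bary 1 x + bary 2 x = 1.
Proof.
have s0 : Num.sqrt 3 != 0 :> R by rewrite gt_eqF // sqrtr_gt0.
by rewrite /bary /=; field.
Qed.

Lemma fst_bary x : x.1 = bary 2 x + bary ord0 x / 2.
Proof.
have s0 : Num.sqrt 3 != 0 :> R by rewrite gt_eqF // sqrtr_gt0.
by rewrite /bary /=; field.
Qed.

Lemma bary_inj x y : (forall i, bary i x = bary i y) -> x = y.
Proof.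
move=> xy; have s0 : Num.sqrt 3 != 0 :> R by rewrite gt_eqF // sqrtr_gt0.
have [x1 x2] : x.1 = y.1 /\ x.2 = y.2.
  split; first by rewrite !fst_bary !xy.
  have := xy ord0; rewrite /bary /= => /(mulIf (invr_neq0 s0)).
  by apply: mulfI; rewrite pnatr_eq0.
by rewrite [x]surjective_pairing [y]surjective_pairing x1 x2.
Qed.

Lemma bary_continuous i : continuous (bary i).
Proof.
move=> x; rewrite /bary; case: i => [[|[|[|//]]] lt_i3] /=.
- by apply: cvgMl; apply: cvgMr; exact: cvg_snd.
- apply: cvgB; first by apply: cvgB; [exact: cvg_cst|exact: cvg_fst].
  by apply: cvgMl; exact: cvg_snd.
- by apply: cvgB; [exact: cvg_fst|apply: cvgMl; exact: cvg_snd].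
Qed.

Definition F_inv i x : plane R := 2 *: (x - q R i) + q R i.

Lemma F_K i : cancel (@F_ R i) (F_inv i).
Proof.
move=> x; rewrite /F_inv /F_ addrK scalerA mulfV ?pnatr_eq0//.
by rewrite scale1r subrK.
Qed.

Lemma F_inj i : injective (@F_ R i).
Proof. exact: can_inj (F_K i). Qed.

Lemma F_fix i : F_ i (q R i) = q R i.
Proof. by rewrite /F_ subrr scaler0 add0r. Qed.

(** Both sides are the midpoint of q_i and q_j; for distinct indices this is where the two
    first-level cells touch. *)
Lemma F_q i j : F_ i (q R j) = F_ j (q R i).
Proof.
apply: bary_inj => k; rewrite !bary_F !bary_q; congr (_ / _); exact: addrC.
Qed.

Lemma F_dist i x y : `|F_ i x - F_ i y| = 2^-1 * `|x - y|.
Proof.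
rewrite /F_ opprD addrACA subrr addr0 -scalerBr opprB addrA subrK.
by rewrite normrZ ger0_norm // invr_ge0.
Qed.

Lemma F_continuous i : continuous (@F_ R i).
Proof.
move=> x; apply: cvgD; last exact: cvg_cst.
by apply: cvgZr; apply: cvgB; [exact: cvg_id|exact: cvg_cst].
Qed.

Lemma Fw_cat w v : Fw (w ++ v) = Fw w \o Fw v :> (plane R -> plane R).
Proof. by apply/funext => x; elim: w => //= i w ->. Qed.

Lemma Fw_inj w : injective (@Fw R w).
Proof. by elim: w => [|i w IH] x y //= /F_inj/IH. Qed.

Lemma Fw_dist w x y : `|Fw w x - Fw w y| = 2^-1 ^+ size w * `|x - y|.
Proof.
elim: w => [|i w IH] /=; first by rewrite expr0 mul1r.
by rewrite F_dist IH exprS mulrA.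
Qed.

Lemma Fw_continuous w : continuous (@Fw R w).
Proof.
elim: w => [|i w IH] x /=; first exact: cvg_id.
by apply: continuous_comp; [exact: IH|exact: F_continuous].
Qed.

Lemma Fw_nseq_q n i : Fw (nseq n i) (q R i) = q R i.
Proof. by elim: n => //= n ->; exact: F_fix. Qed.

End bary.

(** * Geometry of the cells *)

Lemma nbhs_distP (R : realType) (x : plane R) (P : set (plane R)) :
  nbhs x P <-> exists2 d, 0 < d & forall y, `|x - y| < d -> P y.
Proof.
have := @nbhs_normP R (plane R) x P; rewrite /filter_from /=.
by move=> [H1 H2]; split=> [/H1|H]; last exact: H2.
Qed.

Lemma within_continuousP (R : realType) (A : set (plane R)) (f : plane R -> R) :
  {within A, continuous f} <->
  (forall x, A x -> forall e, 0 < e ->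
    exists2 d, 0 < d & forall y, A y -> `|x - y| < d -> `|f x - f y| < e).
Proof.
split=> [/subspace_continuousP cf x Ax e e0|cf].
  have /cvgrPdist_lt/(_ e e0) := cf x Ax.
  rewrite near_withinE => /nbhs_distP[d /= d0 dP].
  by exists d => // y Ay xy; exact: dP.
apply/subspace_continuousP => x Ax; apply/cvgrPdist_lt => e e0.
have [d d0 dP] := cf x Ax e e0; rewrite near_withinE; apply/nbhs_distP.
by exists d => //= y xy Ay; exact: dP.
Qed.

Lemma closed_dist (R : realType) (A : set (plane R)) x : closed A ->
  (forall e, 0 < e -> exists2 y, A y & `|x - y| < e) -> A x.
Proof.
move=> Acl Ax; apply: contrapT => nAx.
have : nbhs x (~` A) by apply: open_nbhs_nbhs; split=> //; exact: closed_openC.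
move=> /nbhs_distP[d d0 dA].
by have [y Ay xy] := Ax d d0; exact: (dA y).
Qed.

Lemma expr2_lt (R : realType) (D e : R) : 0 < e -> exists n, 2^-1 ^+ n * D < e.
Proof.
move=> e0.
have : geometric D 2^-1 @ \oo --> (0 : R).
  by apply: cvg_geometric; rewrite ger0_norm ?invr_ge0 // invf_lt1 // ltr1n.
move=> /cvgrPdist_lt/(_ e e0)[n _ /(_ n (leqnn n))] /=.
rewrite sub0r normrN => De; exists n; rewrite mulrC.
exact: le_lt_trans (ler_norm _) De.
Qed.

Lemma compact_uniformly_continuous (R : realType) (A : set (plane R))
    (f : plane R -> R) :
  compact A -> {within A, continuous f} ->
  forall e, 0 < e -> exists2 d, 0 < d &
    forall x y, A x -> A y -> `|x - y| < d -> `|f x - f y| < e.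
Proof.
move=> /compact_near_coveringP/near_covering_withinP Ac /within_continuousP cf.
move=> e e0; pose P (d : R) x := forall y, A y -> `|x - y| < d -> `|f x - f y| < e.
have /Ac : forall x, A x -> \forall x' \near x & i \near 0^'+, A x' -> P i x'.
  move=> x Ax; have [d d0 dP] := cf x Ax _ (divr_gt0 e0 (ltr0n R 2)).
  exists ([set x' | `|x - x'| < d / 2], [set i | i < d / 2]) => /=.
    split; last by apply: nbhs_right_lt; rewrite divr_gt0.
    by apply/nbhs_distP; exists (d / 2) => //=; rewrite divr_gt0.
  move=> [x' i] /= [xx' id] Ax' y Ay x'y.
  have d2 : d / 2 < d by rewrite ltr_pdivrMr // ltr_pMr // ltr1n.
  have fx' : `|f x - f x'| < e / 2 by apply: dP => //; exact: lt_trans d2.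
  have fy : `|f x - f y| < e / 2.
    apply: dP => //; rewrite -(subrK x' x) -addrA (le_lt_trans (ler_normD _ _)) //.
    by rewrite (splitr d) ltrD // (lt_trans x'y).
  rewrite -(subrK (f x) (f x')) -addrA (le_lt_trans (ler_normD _ _)) //.
  by rewrite (splitr e) ltrD // distrC.
move=> Hd.
have : \forall d \near 0^'+, 0 < d /\ A `<=` P d.
  near=> d; split; first by near: d; exact: nbhs_right_gt.
  by near: d; exact: Hd.
move=> /filter_ex[d [d0 AP]]; exists d => // x y Ax Ay xy; exact: (AP x).
Unshelve. all: by end_near. Qed.

Section gasket_geometry.
Variable R : realType.
Hypothesis attr : is_attractor (@gasket R).
Local Notation K := (@gasket R).
Implicit Types (x y p : plane R) (w v : seq 'I_3).

Lemma compact_gasket : compact K. Proof. by case: attr. Qed.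

Lemma gasketP x : K x <-> exists i y, K y /\ x = F_ i y.
Proof.
have [_ _ KE] := attr; split=> [|[i [y [Ky ->]]]].
  by rewrite {1}KE => -[i _ [y Ky <-]]; exists i, y.
by rewrite KE; exists i => //; exists y.
Qed.

Lemma gasket_F i x : K x -> K (F_ i x).
Proof. by move=> Kx; apply/gasketP; exists i, x. Qed.

Lemma gasket_Fw w x : K x -> K (Fw w x).
Proof. by elim: w => //= i w IH /IH; exact: gasket_F. Qed.

Lemma cell_gasket w : cell w `<=` K.
Proof. by move=> _ [x Kx <-]; exact: gasket_Fw. Qed.

Lemma cell_nil : cell [::] = K.
Proof. exact: image_id. Qed.

Lemma cell_cat w v : cell (w ++ v) = Fw w @` (cell v : set (plane R)).
Proof. by rewrite /cell Fw_cat image_comp. Qed.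

Lemma sub_cell_cat w v : cell (w ++ v) `<=` (cell w : set (plane R)).
Proof. by rewrite cell_cat; apply: image_subset; exact: cell_gasket. Qed.

Lemma cell_Fw w v x : cell v x -> cell (w ++ v) (Fw w x).
Proof. by rewrite cell_cat; exact: imageP. Qed.

Lemma cell_rcons w : cell w = \bigcup_i (cell (rcons w i) : set (plane R)).
Proof.
apply/seteqP; split=> x; last first.
  by move=> [i _]; rewrite -cats1; exact: sub_cell_cat.
move=> [_ /gasketP[i [y [Ky ->]]] <-]; exists i => //.
by rewrite -cats1; apply: cell_Fw; exists y.
Qed.

Lemma gasket_words n x : K x -> exists2 w, size w = n & cell w x.
Proof.
elim: n => [|n IH] Kx; first by exists [::] => //; rewrite cell_nil.
have [w <-] := IH Kx; rewrite cell_rcons => -[i _ wix].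
by exists (rcons w i); rewrite // size_rcons.
Qed.

Lemma compact_cell w : compact (cell w : set (plane R)).
Proof.
apply: continuous_compact; last exact: compact_gasket.
by apply: continuous_subspaceT; exact: Fw_continuous.
Qed.

Lemma closed_cell w : closed (cell w : set (plane R)).
Proof.
apply: compact_closed; last exact: compact_cell.
exact: norm_hausdorff.
Qed.

(** The minimum m over the compact gasket is attained at some F_j(y), where the coordinate is at
    least half of its value at y, hence at least m/2. So m >= m/2. *)
Lemma bary_ge0 i x : K x -> 0 <= bary i x.
Proof.
have [K0 Kc _] := attr.
have cb : {within K, continuous (@bary R i)}.
  by apply: continuous_subspaceT; exact: bary_continuous.
have [c /set_mem Kc' cmin] := compact_EVT_min K0 Kc cb => Kx.
apply: le_trans (cmin x (mem_set Kx)).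
have [j [y [Ky cE]]] := (gasketP c).1 Kc'.
have := cmin y (mem_set Ky); rewrite cE bary_F; case: eqP => _ /=; lra.
Qed.

Lemma bary_le1 i x : K x -> bary i x <= 1.
Proof.
move=> Kx; have := sum_bary x.
by have := bary_ge0 ord0 Kx; have := bary_ge0 1 Kx; have := bary_ge0 2 Kx;
  elim/ord3P: i; lra.
Qed.

Lemma bary_F_ge i x : K x -> 2^-1 <= bary i (F_ i x).
Proof. by move=> Kx; rewrite bary_F eqxx /=; have := bary_ge0 i Kx; lra. Qed.

Lemma bary_F_le i j x : i != j -> K x -> bary i (F_ j x) <= 2^-1.
Proof. by move=> /negbTE ij Kx; rewrite bary_F ij; have := bary_le1 i Kx; rewrite /=; lra. Qed.

Lemma bary_eq1 i x : K x -> bary i x = 1 -> x = q R i.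
Proof.
move=> Kx xi; apply: bary_inj => j; rewrite bary_q.
have := sum_bary x; move: xi.
by have := bary_ge0 ord0 Kx; have := bary_ge0 1 Kx; have := bary_ge0 2 Kx;
  elim/ord3P: i; elim/ord3P: j; rewrite /=; lra.
Qed.

(** The corner is the limit of the iterates of any point of the gasket under the contraction that
    fixes it, and the gasket is closed. *)
Lemma gasket_q i : K (q R i).
Proof.
have [[x Kx] Kc KE] := attr; apply: closed_dist => [|e e0].
  by apply: compact_closed Kc; exact: norm_hausdorff.
have [n ne] := expr2_lt (`|q R i - x| : R) e0.
exists (Fw (nseq n i) x); first exact: gasket_Fw.
by rewrite -{1}(Fw_nseq_q R n i) Fw_dist size_nseq.
Qed.

Lemma cell_q w i : cell w (Fw w (q R i)).
Proof. exact/imageP/gasket_q. Qed.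

Lemma gasket_dist : exists2 D : R, 0 < D & forall x y, K x -> K y -> `|x - y| < D.
Proof.
have /ex_strict_bound_gt0[M M0 KM] := compact_bounded compact_gasket.
exists (M + M) => [|x y Kx Ky]; first exact: addr_gt0.
by rewrite (le_lt_trans (ler_normB _ _)) // ltrD ?KM.
Qed.

Lemma small_cells (e : R) : 0 < e -> exists m, forall w x y, (m <= size w)%N ->
  cell w x -> cell w y -> `|x - y| < e.
Proof.
move=> e0; have [D D0 DP] := gasket_dist; have [m mP] := expr2_lt D e0.
exists m => w _ _ mw [x Kx <-] [y Ky <-]; rewrite Fw_dist.
apply: le_lt_trans mP; apply: ler_pM => //; last exact/ltW/DP.
by rewrite ler_wiXn2l // invf_le1 // ler1n.
Qed.

(** The j-th coordinate of the common point is at least 1/2 because the point lies in F_j(K), and it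
    is half of the j-th coordinate of x. So the latter is 1. *)
Lemma cells_meet i j x y : i != j -> K x -> K y -> F_ i x = F_ j y -> x = q R j.
Proof.
move=> ij Kx Ky xy; apply: bary_eq1 => //.
have := bary_F j i x; rewrite xy bary_F eqxx eq_sym (negbTE ij) /=.
by have := bary_ge0 j Ky; have := bary_le1 j Kx; lra.
Qed.

Lemma q_cell w i : cell w (q R i) -> w = nseq (size w) i.
Proof.
elim: w => [//|j w IH] /= [x Kx] /= jx; have [ij|ij] := eqVneq i j; last first.
  by exfalso; have := bary_F_le ij (gasket_Fw w Kx); rewrite jx bary_q eqxx /=; lra.
congr (_ :: _) => //; apply: IH; exists x => //.
by apply: (@F_inj R j); rewrite jx ij F_fix.
Qed.

(** Equal first letters are stripped. At the first difference the common point is a corner q_l of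
    the remaining gasket, and [q_cell] makes the rest of w constant. This identifies the neighbours
    under ~_n, defined through cells, with pairs of corners of one cell. *)
Lemma vertex_cell w v i : size w = size v -> cell w (Fw v (q R i)) ->
  exists j, Fw v (q R i) = Fw w (q R j).
Proof.
elim: w v => [|k w IH] [|l v] //=; first by exists i.
move=> [wv] [x Kx] /= kx; have [kl|kl] := eqVneq k l.
  have [|j jE] := IH _ wv; last by exists j; rewrite kl jE.
  by exists x => //; apply: (@F_inj R k); rewrite kx kl.
have Kv := gasket_Fw v (gasket_q i); have Kw := gasket_Fw w Kx.
have xl := cells_meet kl Kw Kv kx.
have : cell w (q R l) by rewrite -xl; exists x.
by move=> /q_cell wE; exists l; rewrite -kx xl wE Fw_nseq_q.
Qed.

(** Where the words first differ, [cells_meet] pins every common point to the same corner. Hence an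
    edge belongs to one cell only, and overlaps of cells are null for measures without atoms. *)
Lemma cell_meet w v x y : size w = size v -> w != v ->
  cell w x -> cell v x -> cell w y -> cell v y -> x = y.
Proof.
elim: w v x y => [|k w IH] [|l v] x y //= [wv].
move=> wv' [x1 Kx1 /= <-] [x2 Kx2 /= x12] [y1 Ky1 /= <-] [y2 Ky2 /= y12].
have [kl|kl] := eqVneq k l; last first.
  have := cells_meet kl (gasket_Fw w Kx1) (gasket_Fw v Kx2) (esym x12).
  by have := cells_meet kl (gasket_Fw w Ky1) (gasket_Fw v Ky2) (esym y12) => -> ->.
move: wv' x12 y12; rewrite kl eqseq_cons eqxx /= => wv' /F_inj x12 /F_inj y12.
by congr F_; apply: (IH v) => //; [exists x1|exists x2|exists y1|exists y2].
Qed.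

End gasket_geometry.

(** * Graph energies *)

Section energy_forms.
Variable R : realType.
Implicit Types (u v f g h : plane R -> R) (w : seq 'I_3) (a b c : 'I_3 -> R).

Definition vals u w : 'I_3 -> R := fun i => u (Fw w (q R i)).

Definition E0 a b : R :=
  (a ord0 - a 1) * (b ord0 - b 1) + (a ord0 - a 2) * (b ord0 - b 2) +
  (a 1 - a 2) * (b 1 - b 2).

(* The graph energy of level n, summed over cells instead of edges. *)
Definition En n u v : R :=
  rfac R ^- n * \sum_(w <- words n) E0 (vals u w) (vals v w).

(* The value at the vertex F_i(q_j) of the harmonic extension of a. *)
Definition hext a (i j : 'I_3) : R :=
  if i == j then a i else (a i + a j + \sum_k a k) / 5.

Definition vharmonic g := forall w i j, vals g (rcons w i) j = hext (vals g w) i j.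

Lemma rfac_gt0 : 0 < rfac R.
Proof. by rewrite /rfac divr_gt0. Qed.

Lemma rfacVX_gt0 n : 0 < rfac R ^- n.
Proof. by rewrite invr_gt0 exprn_gt0 // rfac_gt0. Qed.

Lemma vals_comp u w w' : vals (u \o Fw w) w' = vals u (w ++ w').
Proof. by rewrite /vals Fw_cat. Qed.

Lemma E0_ge0 a : 0 <= E0 a a.
Proof. by rewrite /E0 !addr_ge0 // -expr2 sqr_ge0. Qed.

Lemma En0 u v : En 0 u v = E0 (vals u [::]) (vals v [::]).
Proof. by rewrite /En expr0 invr1 mul1r big_seq1. Qed.

Lemma En_cat m n u v : En (m + n) u v =
  rfac R ^- m * \sum_(w <- words m) En n (u \o Fw w) (v \o Fw w).
Proof.
rewrite /En sum_words_cat exprD invfM -mulrA; congr (_ * _).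
rewrite mulr_sumr; apply: eq_bigr => w _; congr (_ * _).
by apply: eq_bigr => w' _; rewrite !vals_comp.
Qed.

Lemma En1E u v : En 1 u v = (rfac R)^-1 *
  (E0 (vals u [:: ord0]) (vals v [:: ord0]) +
   E0 (vals u [:: 1]) (vals v [:: 1]) + E0 (vals u [:: 2]) (vals v [:: 2])).
Proof.
by rewrite /En expr1 (@sum_words_recl _ 0) sum3 /= !big_seq1.
Qed.

(* The factor 3/5 is exactly the one for which minimising the energy of level 1
   over the values at the three midpoints returns the energy of level 0. *)
Lemma En1_ge u : E0 (vals u [::]) (vals u [::]) <= En 1 u u.
Proof.
rewrite En1E /E0 /vals /= !F_fix (F_q _ 1 ord0) (F_q _ 2 ord0) (F_q _ 2 1).
move: (u (q R ord0)) (u (q R 1)) (u (q R 2)) => a b c.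
move: (u (F_ ord0 (q R 1))) (u (F_ ord0 (q R 2))) (u (F_ 1 (q R 2))) => x y z.
pose x' := x - (2 * a + 2 * b + c) / 5.
pose y' := y - (2 * a + 2 * c + b) / 5.
pose z' := z - (2 * b + 2 * c + a) / 5.
rewrite -subr_ge0.
rewrite (_ : _ - _ = 5 / 3 * (2 * x' ^+ 2 + 2 * y' ^+ 2 + 2 * z' ^+ 2 +
   (x' - y') ^+ 2 + (x' - z') ^+ 2 + (y' - z') ^+ 2)).
  by rewrite mulr_ge0 // !addr_ge0 // ?sqr_ge0 // mulr_ge0 // sqr_ge0.
by rewrite /x' /y' /z' /rfac; field.
Qed.

Lemma En_mono u n : En n u u <= En n.+1 u u.
Proof.
rewrite -addn1 En_cat [leLHS]/En; apply: ler_wpM2l; first exact/ltW/rfacVX_gt0.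
apply: ler_sum => w _; apply: le_trans (En1_ge _).
by rewrite !vals_comp cats0.
Qed.

Lemma En_ge0 u n : 0 <= En n u u.
Proof.
apply: mulr_ge0; first exact/ltW/rfacVX_gt0.
by apply: sumr_ge0 => w _; exact: E0_ge0.
Qed.

Lemma vharmonic_comp g w : vharmonic g -> vharmonic (g \o Fw w).
Proof. by move=> gh w' i j; rewrite !vals_comp -rcons_cat. Qed.

(** The values [hext] satisfy Kirchhoff's law at the three midpoints, so the values of [v] there
    cancel. *)
Lemma En1_vharmonic g v : vharmonic g -> En 1 g v = E0 (vals g [::]) (vals v [::]).
Proof.
move=> gh; have g1 i j : vals g [:: i] j = hext (vals g [::]) i j := gh [::] i j.
rewrite En1E /E0 !g1 /hext !sum3 /=.
rewrite /vals /= !F_fix (F_q _ 1 ord0) (F_q _ 2 ord0) (F_q _ 2 1) /rfac.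
by field.
Qed.

Lemma En_vharmonic n g v : vharmonic g -> En n g v = E0 (vals g [::]) (vals v [::]).
Proof.
move=> gh; elim: n => [|n IH]; first exact: En0.
rewrite -IH -addn1 En_cat [RHS]/En; congr (_ * _); apply: eq_bigr => w _.
by rewrite En1_vharmonic; [rewrite !vals_comp cats0|exact: vharmonic_comp].
Qed.

(** A corner value minus a midpoint value is, for instance, (2(a_i - a_j) + (a_i - a_k))/5, hence
    the factor 3/5. That it equals [rfac] is what later balances the factor r^{-n} of the energy. *)
Lemma hext_osc a M : (forall i j, `|a i - a j| <= M) ->
  forall i j k, `|hext a i j - hext a i k| <= 3 / 5 * M.
Proof.
move=> aM.
have := aM ord0 1; have := aM ord0 2; have := aM 1 2; rewrite !ler_norml.
move=> /andP[? ?] /andP[? ?] /andP[? ?].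
by elim/ord3P; elim/ord3P; elim/ord3P; rewrite /hext sum3 /= ler_norml;
  apply/andP; split; lra.
Qed.

Lemma vharmonic_osc g M : vharmonic g ->
  (forall i j, `|vals g [::] i - vals g [::] j| <= M) ->
  forall w i j, `|vals g w i - vals g w j| <= rfac R ^+ size w * M.
Proof.
move=> gh gM w; elim/last_ind: w => [|w k IH] i j.
  by rewrite expr0 mul1r.
by rewrite size_rcons exprS -mulrA !gh; exact: hext_osc.
Qed.

Definition energy_le u (M : R) := forall n, En n u u <= M.

Lemma energy_le_comp u M w :
  energy_le u M -> energy_le (u \o Fw w) (rfac R ^+ size w * M).
Proof.
move=> uM n; have := uM (size w + n)%N; rewrite En_cat.
rewrite ler_pdivrMl ?exprn_gt0 ?rfac_gt0 //; apply: le_trans.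
rewrite (bigD1_seq w) ?uniq_words ?mem_words //= lerDl.
by apply: sumr_ge0 => w' _; exact: En_ge0.
Qed.

Lemma energy_le_ge0 u M : energy_le u M -> 0 <= M.
Proof. by move=> /(_ 0); exact/le_trans/En_ge0. Qed.

Lemma E0_edge a i j : (a i - a j) ^+ 2 <= E0 a a.
Proof.
have := sqr_ge0 (a ord0 - a 1); have := sqr_ge0 (a ord0 - a 2).
have := sqr_ge0 (a 1 - a 2); rewrite /E0 -!expr2 => ? ? ?.
elim/ord3P: i; elim/ord3P: j; rewrite ?subrr ?expr0n /=; lra.
Qed.

(* 16 is not sharp: it only has to satisfy (5/4 * 16 + 5) * 3/5 <= 16. *)
Lemma energy_le_vertex u M w j : energy_le u M ->
  (u (Fw w (q R j)) - u (q R ord0)) ^+ 2 <= 16 * M.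
Proof.
elim: w u M => [|i w IH] u M uM.
  have := E0_edge (vals u [::]) j ord0; have := uM 0%N; rewrite En0 /vals /=.
  have := E0_ge0 (vals u [::]); rewrite /vals; lra.
have := IH _ _ (energy_le_comp [:: i] uM); rewrite /= expr1.
have : (u (F_ i (q R ord0)) - u (q R ord0)) ^+ 2 <= rfac R * M.
  have := energy_le_comp [:: ord0] uM 0; rewrite En0 vals_comp cats0 expr1.
  apply: le_trans; have := E0_edge (vals u [:: ord0]) i ord0.
  by rewrite {1 2}/vals /= F_fix F_q.
rewrite /rfac; move: (u (F_ i (Fw w _))) (u (F_ i (q R ord0))) (u (q R ord0)).
move=> s t r ts sr; have := sqr_ge0 ((s - t) / 2 - (t - r) * 2).
have -> : (s - r) ^+ 2 = 5 / 4 * (s - t) ^+ 2 + 5 * (t - r) ^+ 2 -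
    ((s - t) / 2 - (t - r) * 2) ^+ 2 by field.
have := energy_le_ge0 uM; lra.
Qed.

End energy_forms.

(** * Harmonic functions *)

Section harmonic_functions.
Variable R : realType.
Hypothesis attr : is_attractor (@gasket R).
Local Notation K := (@gasket R).
Implicit Types (u v f g h : plane R -> R) (w : seq 'I_3) (a b : 'I_3 -> R) (c : R).

(** [pr] lists the six ordered pairs of distinct corners. By [cell_meet] no edge comes from two
    cells, so [L] enumerates [adj n] without repetition; the two orientations of an edge absorb the
    factor 1/2. *)
Lemma energy_atE n u v : energy_at n u v = En n u v.
Proof.
pose pr : seq ('I_3 * 'I_3) :=
  [:: (ord0, 1); (ord0, 2); (1, ord0); (1, 2); (2, ord0); (2, 1)].
have prP i j : ((i, j) \in pr) = (i != j) by elim/ord3P: i; elim/ord3P: j.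
pose L := [seq (Fw w (q R ij.1), Fw w (q R ij.2)) | w <- words n, ij <- pr].
have uL : uniq L.
  apply: allpairs_uniq; [exact: uniq_words|by []|].
  move=> x y /allpairsP[[w1 [i1 j1]] [w1n ij1 ->]] /allpairsP[[w2 [i2 j2]]].
  move=> [w2n ij2 ->] /= [e1 e2].
  move: w1n w2n ij1 ij2; rewrite /= !mem_words !prP => /eqP w1n /eqP w2n ij1 ij2.
  have q_inj i k : q R i = q R k -> i = k.
    have [->//|ki /(congr1 (bary k))] := eqVneq k i.
    by rewrite !bary_q eqxx (negbTE ki) => /esym/eqP; rewrite oner_eq0.
  have [ww|ww] := eqVneq w1 w2.
    by move: e1 e2; rewrite ww => /Fw_inj/q_inj -> /Fw_inj/q_inj ->.
  have := cell_meet attr (etrans w1n (esym w2n)) ww (cell_q attr w1 i1) _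
     (cell_q attr w1 j1).
  rewrite e1 e2 => /(_ (cell_q attr w2 i2) (cell_q attr w2 j2)) /Fw_inj/q_inj.
  by move=> ij; move: ij2; rewrite ij eqxx.
have adjE : adj n = [set` L].
  apply/seteqP; split=> [[x y]|[x y] /= /allpairsP[[w [i j]] /= [wn ij [-> ->]]]].
    move=> [/= [w1 w1n [_ [i _ <-] <-]] [w2 w2n [_ [j _ <-] <-]]] xy [w [wn wx wy]].
    have [i' xE] := vertex_cell attr (etrans wn (esym w1n)) wx.
    have [j' yE] := vertex_cell attr (etrans wn (esym w2n)) wy.
    apply/allpairsP; exists (w, (i', j')); split=> /=.
    - by rewrite mem_words wn.
    - by rewrite prP; apply/eqP => ij; apply: xy; rewrite xE yE ij.
    - by rewrite xE yE.
  move: wn; rewrite mem_words => /eqP wn; split=> /=.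
  - by exists w => //; exists (q R i) => //; exists i.
  - by exists w => //; exists (q R j) => //; exists j.
  - move=> /Fw_inj /(congr1 (bary j)); rewrite !bary_q eqxx.
    by move: ij; rewrite prP eq_sym => /negbTE -> /= /eqP; rewrite eq_sym oner_eq0.
  - by exists w; split=> //; exact: cell_q.
rewrite /energy_at adjE -fsbig_seq // /En big_allpairs_dep; congr (_ * _).
rewrite mulr_sumr; apply: eq_bigr => w _.
rewrite !big_cons big_nil /= /E0 /vals; lra.
Qed.

Lemma vertex_dense x e : K x -> 0 < e -> exists w, `|x - Fw w (q R ord0)| < e.
Proof.
move=> Kx e0; have [m mP] := small_cells attr e0.
have [w wm wx] := gasket_words attr m Kx; exists w; apply: (mP w) => //.
  by rewrite wm.
exact: cell_q.
Qed.

Lemma continuous_vertex_le u r : CK u ->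
  (forall w, u (Fw w (q R ord0)) <= r) -> forall x, K x -> u x <= r.
Proof.
move=> /within_continuousP uC ur x Kx; apply/ler_addgt0Pr => e e0.
have [d d0 dP] := uC x Kx e e0; have [w /dP] := vertex_dense Kx d0.
move=> /(_ (gasket_Fw attr w (gasket_q attr ord0))); rewrite ltr_norml => /andP[_ uw].
by have := ur w; lra.
Qed.

Lemma CKP u : CK u <-> (forall x, K x -> forall e, 0 < e ->
  exists2 d, 0 < d & forall y, K y -> `|x - y| < d -> `|u x - u y| < e).
Proof. exact: within_continuousP. Qed.

Lemma CK_cst r : CK (fun=> r : R).
Proof. by move=> x; exact: cst_continuous. Qed.

Lemma CK_D u v : CK u -> CK v -> CK (fun x => u x + v x).
Proof. by move=> cu cv x; apply: cvgD; [exact: cu|exact: cv]. Qed.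

Lemma CK_M u v : CK u -> CK v -> CK (fun x => u x * v x).
Proof. by move=> cu cv x; apply: cvgM; [exact: cu|exact: cv]. Qed.

(** The estimate at vertices extends by density and continuity. It makes functions of energy zero
    constant and bounds the oscillation of [uL] and [uR] on each cell. *)
Lemma energy_le_osc u M x : CK u -> energy_le u M -> K x ->
  (u x - u (q R ord0)) ^+ 2 <= 16 * M.
Proof.
move=> uC uM; pose v x := u x - u (q R ord0).
have vC : CK v by apply: CK_D => //; exact: CK_cst.
apply: (@continuous_vertex_le (fun x => v x * v x)); first exact: CK_M.
by move=> w; exact: energy_le_vertex.
Qed.

Lemma domFP u : domF u <-> CK u /\ exists M, energy_le u M.
Proof.
by split=> -[uC [M uM]]; split=> //; exists M => n; move: (uM n); rewrite energy_atE.
Qed.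

Lemma domF_lin r s u v : domF u -> domF v -> domF (fun x => r * u x + s * v x).
Proof.
move=> /domFP[uC [M uM]] /domFP[vC [N vN]]; apply/domFP; split.
  by apply: CK_D; apply: CK_M => //; exact: CK_cst.
exists (2 * r ^+ 2 * M + 2 * s ^+ 2 * N) => n.
apply: (@le_trans _ _ (2 * r ^+ 2 * En n u u + 2 * s ^+ 2 * En n v v)); last first.
  by apply: lerD; apply: ler_wpM2l => //; rewrite mulr_ge0 // sqr_ge0.
rewrite /En !(mulrCA _ (_ ^- n)) -mulrDr.
apply: ler_wpM2l; first exact/ltW/rfacVX_gt0.
rewrite !mulr_sumr -big_split; apply: ler_sum => w _; rewrite /= /E0 /vals.
set a := u _; set a1 := u _; set a2 := u _; set b := v _; set b1 := v _; set b2 := v _.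
(* The parallelogram law on each edge: 2x^2 + 2y^2 - (x + y)^2 = (x - y)^2. *)
rewrite -subr_ge0 (_ : _ - _ = (r * (a - a1) - s * (b - b1)) ^+ 2 +
  (r * (a - a2) - s * (b - b2)) ^+ 2 + (r * (a1 - a2) - s * (b1 - b2)) ^+ 2).
  by rewrite !addr_ge0 // sqr_ge0.
by ring.
Qed.

Lemma domF0_lin r s u v : domF0 u -> domF0 v -> domF0 (fun x => r * u x + s * v x).
Proof.
move=> [uF u0] [vF v0]; split; first exact: domF_lin.
by move=> p Vp; rewrite u0 // v0 // !mulr0 addr0.
Qed.

(** The finitely many closed cells of level n that miss x stay at a positive distance from it. *)
Lemma near_cells x n : K x -> exists2 d, 0 < d & forall y, K y -> `|x - y| < d ->
  exists w, [/\ size w = n, cell w x & cell w y].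
Proof.
move=> Kx.
have [d d0 dP] : exists2 d, 0 < d & forall w, w \in words n -> ~ cell w x ->
    forall y, `|x - y| < d -> ~ cell w y.
  elim: (words n) => [|w s [d d0 dP]]; first by exists 1.
  have [wx|wx] := pselect (cell w x).
    exists d => // w'; rewrite inE => /orP[/eqP ->//|]; exact: dP.
  have : nbhs x (~` cell w).
    by apply: open_nbhs_nbhs; split=> //; apply: closed_openC; exact: closed_cell.
  move=> /nbhs_distP[d' d'0 d'P]; exists (Num.min d d'); first by rewrite lt_min d0.
  move=> w'; rewrite inE => /orP[/eqP -> _|w's w'x] y; rewrite lt_min => /andP[? ?].
    exact: d'P.
  exact: (dP w').
exists d => // y Ky xy; have [w wn wy] := gasket_words attr n Ky.
exists w; split=> //; apply: contrapT => wx.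
by apply: (dP w _ wx y xy wy); rewrite mem_words wn.
Qed.

(* A junction point lies in two cells and gets the smaller digit. *)
Definition digit (x : plane R) : 'I_3 :=
  if 2^-1 <= bary ord0 x then ord0 else if 2^-1 <= bary 1 x then 1 else 2.

(* The value of the harmonic extension at the corner q_0 of the n-th cell along
   the address of x. *)
Fixpoint approx n a x : R :=
  if n is m.+1 then approx m (hext a (digit x)) (F_inv (digit x) x) else a ord0.

Definition extension a x : R := lim (approx n a x @[n --> \oo]).

Lemma hext_dist a c M i j : (forall k, `|a k - c| <= M) -> `|hext a i j - c| <= M.
Proof.
move=> aM; have := aM ord0; have := aM 1; have := aM 2.
rewrite !ler_norml => /andP[? ?] /andP[? ?] /andP[? ?].
by elim/ord3P: i; elim/ord3P: j; rewrite /hext sum3 /=; apply/andP; split; lra.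
Qed.

Lemma approx_dist n a x c M : (forall k, `|a k - c| <= M) -> `|approx n a x - c| <= M.
Proof.
by elim: n a x => [|n IH] a x aM /=; [exact: aM|apply: IH => k; exact: hext_dist].
Qed.

Definition osc a := `|a ord0 - a 1| + `|a 1 - a 2| + `|a ord0 - a 2|.

Lemma le_osc a i j : `|a i - a j| <= osc a.
Proof.
have := normr_ge0 (a ord0 - a 1); have := normr_ge0 (a 1 - a 2).
have := normr_ge0 (a ord0 - a 2); rewrite /osc => ? ? ?.
have := distrC (a 1) (a ord0); have := distrC (a 2) (a ord0).
have := distrC (a 2) (a 1) => ? ? ?.
by elim/ord3P: i; elim/ord3P: j; rewrite ?subrr ?normr0; lra.
Qed.

Lemma approx_cauchy a x M n m : (forall i j, `|a i - a j| <= M) ->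
  `|approx (n + m) a x - approx n a x| <= (3 / 5) ^+ n * M.
Proof.
elim: n a x M => [|n IH] a x M aM.
  by rewrite expr0 mul1r add0n; apply: (@approx_dist _ _ _ (a ord0)) => k; exact: aM.
by rewrite addSn /= exprSr -mulrA; apply: IH => i j; exact: hext_osc.
Qed.

Lemma geometric_cauchy_cvg (s : nat -> R) M : (forall n m,
  `|s (n + m)%N - s n| <= (3 / 5) ^+ n * M) -> cvg (s n @[n --> \oo]).
Proof.
move=> sM; apply/cauchy_cvgP/cauchy_ballP => e e0; rewrite near_simpl.
have : geometric M (3 / 5) @ \oo --> (0 : R).
  by apply: cvg_geometric; rewrite ger0_norm //; lra.
move=> /cvgrPdist_lt/(_ (e / 2) (divr_gt0 e0 (ltr0n _ 2)))[N _].
move=> /(_ N (leqnn N)) /=; rewrite sub0r normrN mulrC => MN.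
have sN n : (N <= n)%N -> `|s n - s N| < e / 2.
  by move=> /subnKC <-; apply: le_lt_trans (sM _ _) (le_lt_trans (ler_norm _) MN).
exists ([set n | (N <= n)%N], [set n | (N <= n)%N]).
  by split; exists N.
move=> [n m] /= [Nn Nm]; rewrite /ball /= (splitr e).
rewrite -(subrK (s N) (s n)) -addrA (le_lt_trans (ler_normD _ _)) // ltrD ?sN //.
by rewrite distrC sN.
Qed.

Lemma extension_cvg a x : approx n a x @[n --> \oo] --> extension a x.
Proof.
apply: (@geometric_cauchy_cvg _ (osc a)) => n m; apply: approx_cauchy.
exact: le_osc.
Qed.

Lemma extensionE a x b y : (forall n, approx n.+1 a x = approx n b y) ->
  extension a x = extension b y.
Proof.
move=> ab; apply: cvg_lim => //; rewrite -cvg_shiftS.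
have -> : (fun n => approx n.+1 a x) = (fun n => approx n b y) by exact/funext.
exact: extension_cvg.
Qed.

Lemma extension_dist a x c M :
  (forall k, `|a k - c| <= M) -> `|extension a x - c| <= M.
Proof.
move=> aM; have := @extension_cvg a x.
have : closed [set r : R | `|r - c| <= M].
  have -> : [set r : R | `|r - c| <= M] = (fun r => `|r - c|) @^-1` [set r | r <= M].
    by [].
  apply: closed_comp; last exact: closed_le.
  by move=> r _; apply: cvg_norm; apply: cvgB; [exact: cvg_id|exact: cvg_cst].
move=> /closed_cvg; apply; apply: nearW => n; exact: approx_dist.
Qed.

Lemma digit_q i : digit (q R i) = i.
Proof.
have h0 : 2^-1 <= (0 : R) = false by apply/negbTE; rewrite -ltNge invr_gt0.
have h1 : 2^-1 <= (1 : R) by rewrite invf_le1 // ler1n.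
by rewrite /digit !bary_q; elim/ord3P: i; rewrite /= ?h0 ?h1.
Qed.

Lemma bary_digit x : K x -> 2^-1 <= bary (digit x) x.
Proof.
move=> /(gasketP attr)[i [y [Ky xE]]]; rewrite /digit.
have := bary_F_ge attr i Ky; rewrite -xE.
by case: ifPn => // b0; case: ifPn => // b1; elim/ord3P: i xE;
  [move=> _ ?; lra|move=> _ ?; lra|].
Qed.

Lemma extension_q a i : extension a (q R i) = a i.
Proof.
apply: cvg_lim => //; apply/cvgrPdist_lt => e e0.
have : geometric (osc a) (3 / 5) @ \oo --> (0 : R).
  by apply: cvg_geometric; rewrite ger0_norm //; lra.
move=> /cvgrPdist_lt/(_ e e0); apply: filterS => n /=.
rewrite sub0r normrN => /(le_lt_trans (ler_norm _)); apply: le_lt_trans.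
have : forall j k, `|a j - a k| <= osc a by exact: le_osc.
rewrite mulrC; elim: n a (osc a) => [|n IH] a M aM; first by rewrite expr0 mul1r distrC; exact: aM.
rewrite /= digit_q -[in F_inv _ _](F_fix R i) F_K exprSr -mulrA.
have {1}-> : a i = hext a i i by rewrite /hext eqxx.
by apply: IH => j k; exact: hext_osc.
Qed.

Lemma hextC a i j : hext a i j = hext a j i.
Proof. by rewrite /hext eq_sym; case: eqP => [->//|_]; rewrite (addrC (a i)). Qed.

(** Independence of the address. If the digit d of F_i(x) is not i, then x = q_d and the point is
    F_i(q_d) = F_d(q_i); the two addresses give the same value by the symmetry [hextC]. *)
Lemma extension_F a i x : K x -> extension a (F_ i x) = extension (hext a i) x.
Proof.
move=> Kx; have [dE|di] := eqVneq (digit (F_ i x)) i.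
  by apply: extensionE => n /=; rewrite dE F_K.
have : bary (digit (F_ i x)) x = 1.
  have := bary_digit (gasket_F attr i Kx).
  by have := bary_le1 attr (digit (F_ i x)) Kx; rewrite bary_F (negbTE di) /=; lra.
have [d dE] : {d | digit (F_ i x) = d} by eexists.
rewrite dE => /(bary_eq1 attr Kx) xE.
rewrite [in RHS]xE extension_q hextC -(extension_q (hext a d) i).
by apply: extensionE => n /=; rewrite dE xE F_q F_K.
Qed.

Definition hext_word a w := foldl (@hext R) a w.

Lemma extension_Fw a w x : K x -> extension a (Fw w x) = extension (hext_word a w) x.
Proof.
by move=> Kx; elim: w a => //= i w IH a; rewrite extension_F ?IH //; exact: gasket_Fw.
Qed.

Lemma extension_vharmonic a : vharmonic (extension a).
Proof.
have vE w i : vals (extension a) w i = hext_word a w i.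
  by rewrite /vals extension_Fw ?extension_q //; exact: gasket_q.
move=> w i j; rewrite vE /hext_word foldl_rcons.
by congr (hext _ i j); apply/funext => k; rewrite vE.
Qed.

Lemma hext_word_osc a w i j : `|hext_word a w i - hext_word a w j| <=
  (3 / 5) ^+ size w * osc a.
Proof.
move: (@le_osc a) i j; rewrite /hext_word; move: (osc a).
elim: w a => [|k w IH] a M aM i j; first by rewrite expr0 mul1r.
by rewrite /= exprSr -mulrA; apply: IH => ? ?; exact: hext_osc.
Qed.

(** Points close to x share a cell of level n with x, and on such a cell the extension stays within
    (3/5)^n times the initial oscillation of one corner value. *)
Lemma extension_CK a : CK (extension a).
Proof.
apply/CKP => x Kx e e0.
have : geometric (osc a) (3 / 5) @ \oo --> (0 : R).
  by apply: cvg_geometric; rewrite ger0_norm //; lra.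
move=> /cvgrPdist_lt/(_ (e / 2) (divr_gt0 e0 (ltr0n _ 2)))[n _].
move=> /(_ n (leqnn n)) /=; rewrite sub0r normrN mulrC => /(le_lt_trans (ler_norm _)) oe.
have [d d0 dP] := near_cells n Kx; exists d => // y Ky /(dP y Ky)[w [wn]].
have wE z : cell w z -> `|extension a z - hext_word a w ord0| < e / 2.
  move=> [z' Kz' <-]; rewrite extension_Fw //; apply: le_lt_trans oe.
  by rewrite -wn; apply: extension_dist => k; exact: hext_word_osc.
move=> /wE wx /wE wy; rewrite -(subrK (hext_word a w ord0) (extension a x)) -addrA.
by rewrite (le_lt_trans (ler_normD _ _)) // (splitr e) ltrD // distrC.
Qed.

Lemma extension_domF a : domF (extension a).
Proof.
apply/domFP; split; first exact: extension_CK.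
by eexists => n; rewrite En_vharmonic //; exact: extension_vharmonic.
Qed.

Lemma energyE u v : energy u v = lim (En n u v @[n --> \oo]).
Proof.
rewrite /energy (_ : (fun n => energy_at n u v) = (fun n => En n u v)) //.
by apply/funext => n; exact: energy_atE.
Qed.

(* f = h - extension vanishes on V_0, so it is orthogonal to both terms and has
   energy 0; hence it is constant. *)
Lemma harmonic_extension h x : is_harmonic h -> K x ->
  h x = extension (vals h [::]) x.
Proof.
move=> [hF hE]; set g := extension _; pose f x := 1 * h x + -1 * g x.
have fF : domF0 f.
  split; first by apply: domF_lin => //; exact: extension_domF.
  by move=> _ [i _ <-]; rewrite /f /g extension_q /vals /= mul1r mulN1r subrr.
have EnE n : En n h f = En n f f.
  transitivity (En n h f - En n g f).
    rewrite (En_vharmonic n f (@extension_vharmonic _)) /E0.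
    have f0 i : vals f [::] i = 0 by apply: fF.2; exists i.
    by rewrite !f0 !subrr !mulr0 !addr0 subr0.
  rewrite /En -mulrBr -sumrB; congr (_ * _); apply: eq_bigr => w _.
  by rewrite /E0 /vals /f; ring.
have [fC [M fM]] := (domFP f).1 fF.1.
have f0 n : En n f f <= 0.
  have : lim (En n f f @[n --> \oo]) = 0.
    rewrite -[RHS](hE f fF) energyE (_ : (fun n => En n h f) = (fun n => En n f f)) //.
    exact/funext.
  move=> <-; apply: (@nondecreasing_cvgn_le _ (fun n => En n f f)).
    by apply/nondecreasing_seqP => m; exact: En_mono.
  apply: nondecreasing_is_cvgn.
    by apply/nondecreasing_seqP => m; exact: En_mono.
  by exists M => _ [m _ <-].
move=> Kx; have := energy_le_osc fC f0 Kx.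
rewrite mulr0 (fF.2 (q R ord0)); last by exists ord0.
move=> f2; have : f x = 0.
  by apply/eqP; rewrite -[_ == 0]sqrf_eq0 eq_le sqr_ge0 andbT; rewrite subr0 in f2.
by rewrite /f /g; lra.
Qed.

(** Passage from the weak definition to the pointwise extension rule, the form in which harmonicity
    enters all energy computations below. *)
Lemma harmonic_vharmonic h : is_harmonic h -> vharmonic h.
Proof.
move=> hh; have vE w : vals h w = vals (extension (vals h [::])) w.
  by apply/funext => i; rewrite /vals (harmonic_extension hh) //; apply: gasket_Fw => //;
    exact: gasket_q.
by move=> w i j; rewrite (vE (rcons w i)) (vE w); exact: extension_vharmonic.
Qed.

(** The graph energies of [h] against [u] inside the cell do not change with the level, so the limit
    is that of a constant sequence. This makes the cell values of the energy charges explicit. *)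
Lemma cell_energy_vharmonic w h u : vharmonic h ->
  cell_energy w h u = rfac R ^- size w * E0 (vals h w) (vals u w).
Proof.
move=> hh; rewrite /cell_energy energyE; congr (_ * _).
rewrite (_ : (fun n => _) = fun=> E0 (vals h w) (vals u w)) ?lim_cst //=.
apply/funext => n; rewrite En_vharmonic; last exact: vharmonic_comp.
by rewrite !vals_comp cats0.
Qed.

End harmonic_functions.

(** * Measurability and integrals of bounded functions *)

Section plane_measurability.
Variable R : realType.
Implicit Types (A D : set (plane R)) (f : plane R -> R).

(** Measurability refers to the product sigma-algebra, while the topology is that of the norm.
    Rational boxes link the two: [B'] keeps those boxes that lie inside A, and countably many of
    them cover A. *)
Lemma open_plane_measurable A : open A -> measurable A.
Proof.
move=> oA; pose B (c : rat * rat * rat) : set (plane R) :=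
  [set x | `|ratr c.1.1 - x| < ratr c.2] `*` [set y | `|ratr c.1.2 - y| < ratr c.2].
pose B' c := if `[< B c `<=` A >] then B c else set0.
have -> : A = \bigcup_c B' c.
  apply/seteqP; split=> [x Ax|x [c _]]; last first.
    by rewrite /B'; case: asboolP => // cA; exact: cA.
  have /nbhs_distP[d d0 dA] : nbhs x A by apply: open_nbhs_nbhs.
  have d2 : 0 < d / 2 by rewrite divr_gt0.
  have [e] : exists e : rat, ratr e \in `]0, (d / 2)[.
    by have [e ?] := rat_in_itvoo d2; exists e.
  rewrite in_itv /= => /andP[e0 ed].
  have ra (r : R) : exists a : rat, `|ratr a - r| < ratr e.
    have [|a] := @rat_in_itvoo R (r - ratr e) (r + ratr e); first by lra.
    by rewrite in_itv /= => /andP[? ?]; exists a; rewrite ltr_norml; apply/andP; split; lra.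
  have [a aP] := ra x.1; have [b bP] := ra x.2.
  exists (a, b, e) => //; rewrite /B'; case: asboolP => [_|]; first by split.
  case=> y [/= ya yb]; apply: dA; rewrite prod_normE gt_max /=.
  move: aP bP ya yb; rewrite !ltr_norml => /andP[? ?] /andP[? ?] /andP[? ?] /andP[? ?].
  by apply/andP; split; apply/andP; split; lra.
apply: countable_bigcupT_measurable => // c; rewrite /B'; case: asboolP => // _.
apply: measurableX.
- by rewrite (_ : [set _ | _] = ball (ratr c.1.1 : R) (ratr c.2)) //; exact: measurable_ball.
- by rewrite (_ : [set _ | _] = ball (ratr c.1.2 : R) (ratr c.2)) //; exact: measurable_ball.
Qed.

Lemma closed_plane_measurable A : closed A -> measurable A.
Proof.
by move=> /closed_openC/open_plane_measurable/measurableC; rewrite setCK.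
Qed.

Lemma plane_set1_measurable (p : plane R) : measurable [set p].
Proof.
by apply: closed_plane_measurable; apply/accessible_closed_set1/hausdorff_accessible;
  exact: norm_hausdorff.
Qed.

Lemma continuous_plane_measurable D f :
  measurable D -> {within D, continuous f} -> measurable_fun D f.
Proof.
move=> mD /continuousP cf; apply: (measurability _ (RGenOpens.measurableE R)).
move=> _ [_ [a [b ->] <-]].
have oab : open `]a, b[%classic by exact: interval_open.
have /open_subspaceP[V oV VD] := cf _ oab.
by rewrite setIC -VD; apply: measurableI => //; exact: open_plane_measurable.
Qed.

End plane_measurability.

Section bounded_integrals.
Context d (T : measurableType d) (R : realType).
Variable mu : {finite_measure set T -> \bar R}.
Implicit Types (A B D : set T) (f g : T -> R).

Definition mass A : R := fine (mu A).

Lemma massE A : measurable A -> (mass A)%:E = mu A.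
Proof. by move=> mA; rewrite fineK // fin_num_measure. Qed.

Lemma mass_ge0 A : 0 <= mass A.
Proof. exact: fine_ge0. Qed.

Lemma le_mass A B : measurable A -> measurable B -> A `<=` B -> mass A <= mass B.
Proof.
by move=> mA mB AB; rewrite -lee_fin !massE //; apply: le_measure; rewrite ?inE.
Qed.

Lemma bounded_integrable D f M : measurable D -> measurable_fun D f ->
  (forall x, D x -> `|f x| <= M) -> mu.-integrable D (EFin \o f).
Proof.
move=> mD mf fM; apply: measurable_bounded_integrable => //.
  by have /fin_numPlt/andP[] := fin_num_measure mu D mD.
exists M; split; first by rewrite num_real.
by move=> N MN x Dx; exact: le_trans (fM x Dx) (ltW MN).
Qed.

Lemma Rintegral_null D f : measurable D -> measurable_fun D f -> mu D = 0%E ->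
  \int[mu]_(x in D) f x = 0.
Proof.
by move=> mD mf D0; rewrite /Rintegral null_set_integral //; exact/measurable_EFinP.
Qed.

Lemma Rintegral_setU_null A B f : measurable A -> measurable B ->
  mu (A `&` B) = 0%E -> mu.-integrable (A `|` B) (EFin \o f) ->
  \int[mu]_(x in A `|` B) f x = \int[mu]_(x in A) f x + \int[mu]_(x in B) f x.
Proof.
move=> mA mB AB0 fi; have mAB := measurableI _ _ mA mB.
have mBA := measurableD mB mA.
have fB : mu.-integrable B (EFin \o f).
  by apply: integrableS fi => //; exact: measurableU.
have mf : measurable_fun (A `&` B) f.
  apply/measurable_EFinP; apply: measurable_funS (measurable_int _ fB) => //.
have BE : \int[mu]_(x in B) f x = \int[mu]_(x in B `\` A) f x.
  have BU : B = (B `\` A) `|` (A `&` B) by rewrite setIC setUC setUIDK.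
  rewrite {1}BU Rintegral_setU //.
  - by rewrite (Rintegral_null mAB mf AB0) addr0.
  - by rewrite -BU.
  - by apply/disj_setPS => x [[_ nAx] [Ax]].
have AU : A `|` B = A `|` (B `\` A).
  apply/seteqP; split=> x; last by move=> [Ax|[Bx _]]; [left|right].
  by have [Ax|nAx] := pselect (A x); [left|move=> [//|Bx]; right].
rewrite BE AU Rintegral_setU //; first by rewrite -AU.
by apply/disj_setPS => x [Ax [_ /(_ Ax)]].
Qed.

Lemma Rintegral_dist D f g e : measurable D ->
  mu.-integrable D (EFin \o f) -> mu.-integrable D (EFin \o g) ->
  (forall x, D x -> `|f x - g x| <= e) ->
  `|\int[mu]_(x in D) f x - \int[mu]_(x in D) g x| <= e * mass D.
Proof.
move=> mD fi gi fg; rewrite -RintegralB //.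
have fgi : mu.-integrable D (EFin \o (fun x => f x - g x)).
  by rewrite (_ : _ \o _ = (EFin \o f) \- (EFin \o g))%E //; exact: integrableB.
apply: le_trans (le_normr_Rintegral mD fgi) _.
rewrite -(Rintegral_cst mu mD e); apply: le_Rintegral => //.
  by rewrite (_ : _ \o _ = abse \o (EFin \o (fun x => f x - g x))) //; exact: integrable_abse.
exact: finite_measure_integrable_cst.
Qed.

Lemma bounded_convergence D (f_ : nat -> T -> R) f M (N : set T) :
  measurable D -> (forall n, measurable_fun D (f_ n)) -> measurable_fun D f ->
  measurable N -> mu N = 0%E ->
  (forall x, D x -> ~ N x -> f_ n x @[n --> \oo] --> f x) ->
  (forall n x, D x -> `|f_ n x| <= M) ->
  \int[mu]_(x in D) f_ n x @[n --> \oo] --> \int[mu]_(x in D) f x.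
Proof.
move=> mD mf_ mf mN N0 f_f f_M.
have f_i n : mu.-integrable D (EFin \o f_ n) by exact: bounded_integrable (f_M n).
have [||||| fi _] := @dominated_convergence _ _ _ mu D mD (fun n => EFin \o f_ n)
  (EFin \o f) (EFin \o cst M).
- by move=> n; exact/measurable_EFinP.
- exact/measurable_EFinP.
- exists N; split=> // x /= xP; apply: contrapT => nNx; apply: xP => Dx.
  by apply/cvg_EFin; [exact: nearW|exact: f_f].
- exact: finite_measure_integrable_cst.
- by apply: aeW => x n Dx; rewrite lee_fin f_M.
by rewrite -(fineK (integrable_fin_num mD fi)); exact: fine_cvg.
Qed.

End bounded_integrals.

(** * Measures and charges on cells *)

Section gasket_measure.
Variable R : realType.
Hypothesis attr : is_attractor (@gasket R).
Local Notation K := (@gasket R).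
Implicit Types (w v : seq 'I_3) (f : plane R -> R).

Lemma cell_measurable w : measurable (cell w : set (plane R)).
Proof. by apply: closed_plane_measurable; exact: closed_cell. Qed.

Lemma gasket_measurable : measurable K.
Proof. by rewrite -cell_nil; exact: cell_measurable. Qed.

Definition atomless (mu : set (plane R) -> \bar R) :=
  forall p, K p -> mu [set p] = 0%E.

Section cells.
Variable mu : {finite_measure set (plane R) -> \bar R}.
Hypothesis mu0 : atomless mu.

Lemma atomless_subset1 (A : set (plane R)) :
  A `<=` K -> (forall x y, A x -> A y -> x = y) -> mu A = 0%E.
Proof.
move=> AK A1; have [->|/set0P[p Ap]] := eqVneq A set0; first exact: measure0.
rewrite (_ : A = [set p]); first by apply: mu0; exact: AK.
by apply/seteqP; split=> [x Ax|x ->//]; exact: A1.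
Qed.

Lemma cell_rcons_null w i j : i != j ->
  mu (cell (rcons w i) `&` cell (rcons w j)) = 0%E.
Proof.
move=> ij; apply: atomless_subset1; first by move=> x [/(cell_gasket attr)].
move=> x y [xi xj] [yi yj]; apply: (cell_meet attr _ _ xi xj yi yj).
  by rewrite !size_rcons.
by apply: contra ij => /eqP/rcons_inj[->].
Qed.

Lemma Rintegral_cell_rcons w f : mu.-integrable (cell w) (EFin \o f) ->
  \int[mu]_(x in cell w) f x =
  \sum_(i < 3) \int[mu]_(x in cell (rcons w i)) f x.
Proof.
have cE : cell w = cell (rcons w ord0) `|` cell (rcons w 1) `|` cell (rcons w 2)
    :> set (plane R).
  rewrite (cell_rcons attr); apply/seteqP; split=> x.
    by move=> [i _]; elim/ord3P: i => ?; [left; left|left; right|right].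
  by move=> [[]|] ?; [exists ord0|exists 1|exists 2].
have m i := cell_measurable (rcons w i).
rewrite cE sum3 => fi; rewrite Rintegral_setU_null //; first last.
- rewrite setIUl; apply: null_set_setU; try exact: cell_rcons_null.
    by apply: measurableI.
  by apply: measurableI.
- exact: measurableU.
congr (_ + _); apply: Rintegral_setU_null => //; first exact: cell_rcons_null.
apply: (integrableS _ _ _ fi); last exact: subsetUl.
  by do 2?apply: measurableU.
by apply: measurableU.
Qed.

Lemma mass_cell_rcons w : mass mu (cell w) = \sum_(i < 3) mass mu (cell (rcons w i)).
Proof.
have := @Rintegral_cell_rcons w (cst 1).
rewrite Rintegral_cst ?mul1r; last exact: cell_measurable.
rewrite /mass => ->; last by apply: finite_measure_integrable_cst; exact: cell_measurable.
by apply: eq_bigr => i _; rewrite Rintegral_cst ?mul1r //; exact: cell_measurable.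
Qed.

(** Induction on the depth: a cell splits into its three children, whose overlaps are null, and both
    the integrals and the masses add up. *)
Lemma Riemann_dist m w f (c : seq 'I_3 -> R) (e : R) :
  mu.-integrable (cell w) (EFin \o f) ->
  (forall v x, size v = m -> cell (w ++ v) x -> `|f x - c v| <= e) ->
  `|\int[mu]_(x in cell w) f x -
    \sum_(v <- words m) c v * mass mu (cell (w ++ v))| <= e * mass mu (cell w).
Proof.
elim: m w c => [|m IH] w c fi fc.
  rewrite big_seq1 cats0 -(Rintegral_cst mu (cell_measurable w)).
  apply: Rintegral_dist => //; first exact: cell_measurable.
    by apply: finite_measure_integrable_cst; exact: cell_measurable.
  by move=> x wx; apply: fc => //; rewrite cats0.
rewrite Rintegral_cell_rcons // sum_words_recl mass_cell_rcons -sumrB mulr_sumr.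
apply: le_trans (ler_norm_sum _ _ _) _; apply: ler_sum => i _.
under [X in _ - X]eq_bigr do rewrite -cat_rcons.
apply: IH.
  apply: integrableS fi => //; try exact: cell_measurable.
  by rewrite -cats1; exact: (sub_cell_cat attr).
by move=> v x vm; rewrite cat_rcons => vx; apply: fc => //=; rewrite vm.
Qed.

End cells.

(** If the digit d differs from the i of a given preimage, the point is the junction F_i(q_d) =
    F_d(q_i), whose preimage under F_d is the corner q_i. *)
Lemma gasket_F_inv x : K x -> K (F_inv (digit x) x).
Proof.
move=> Kx; have := bary_digit attr Kx; have [i [y [Ky xE]]] := (gasketP attr x).1 Kx.
have [d dE] : {d | digit x = d} by eexists.
rewrite dE; have [->|di] := eqVneq d i; first by rewrite xE F_K.
move=> bd; have yE : y = q R d.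
  apply: bary_eq1 => //; move: bd; rewrite xE bary_F (negbTE di) /=.
  by have := bary_le1 attr d Ky; lra.
by rewrite xE yE F_q F_K; exact: gasket_q.
Qed.

Fixpoint address n (x : plane R) : seq 'I_3 :=
  if n is m.+1 then digit x :: address m (F_inv (digit x) x) else [::].

Lemma size_address n x : size (address n x) = n.
Proof. by elim: n x => //= n IH x; rewrite IH. Qed.

Lemma F_invK i : cancel (@F_inv R i) (F_ i).
Proof.
move=> x; rewrite /F_ /F_inv addrK scalerA mulVf ?pnatr_eq0 //.
by rewrite scale1r subrK.
Qed.

Lemma cell_address n x : K x -> cell (address n x) x.
Proof.
elim: n x => [|n IH] x Kx /=; first by rewrite cell_nil.
have := IH _ (gasket_F_inv Kx); rewrite -cat1s => /(cell_Fw [:: digit x]) /=.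
by rewrite F_invK.
Qed.

Lemma address_nonincreasing x n : cell (address n.+1 x) `<=` (cell (address n x) : set (plane R)).
Proof.
elim: n x => [|n IH] x; first by rewrite [X in _ `<=` X]cell_nil; exact: cell_gasket.
rewrite -[address n.+1 x]/([:: digit x] ++ _) -[address n.+2 x]/([:: digit x] ++ address n.+1 _).
by rewrite !cell_cat; apply: image_subset; exact: IH.
Qed.

Lemma bigcap_cell_address x : K x -> \bigcap_n cell (address n x) = [set x].
Proof.
move=> Kx; apply/seteqP; split=> [y yx|_ -> n _]; last exact: cell_address.
apply/eqP/negPn/negP => xy; have e0 : 0 < `|y - x| by rewrite normr_gt0 subr_eq0.
have [m mP] := small_cells attr e0.
have := mP (address m x) y x; rewrite size_address leqnn ltxx => /(_ isT).
by move=> /(_ (yx m I) (cell_address m Kx)).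
Qed.

(** Continuity from above along the nested cells of the address, whose intersection is the point
    x. *)
Lemma mass_set1_cvg (mu : {finite_measure set (plane R) -> \bar R}) x : K x ->
  mass mu (cell (address n x)) @[n --> \oo] --> mass mu [set x].
Proof.
move=> Kx; apply: fine_cvg; rewrite (massE mu (plane_set1_measurable x)).
rewrite -(bigcap_cell_address Kx).
apply: (@nonincreasing_cvg_mu _ _ _ mu (fun n => cell (address n x))).
- by have /fin_numPlt/andP[] := fin_num_measure mu _ (cell_measurable (address 0 x)).
- by move=> n; exact: cell_measurable.
- by apply: bigcapT_measurable => n; exact: cell_measurable.
- by apply/nonincreasing_seqP => n; apply/subsetPset; exact: address_nonincreasing.
Qed.

Section charge.
Variable nu : {charge set (plane R) -> \bar R}.
Local Notation pos := (jordan_pos (hahnP nu)).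
Local Notation neg := (jordan_neg (hahnP nu)).

Lemma fine_charge A : measurable A -> fine (nu A) = mass pos A - mass neg A.
Proof.
move=> mA; rewrite (jordan_decomp (hahnP nu) mA).
have -> : cadd pos (cscale (-1) neg) A = (pos A - neg A)%E.
  by rewrite /cadd /= cscaleN1.
rewrite fineB //; exact: fin_num_measure.
Qed.

Hypothesis small_nu : forall e : R, 0 < e -> exists m, forall w, (m <= size w)%N ->
  `|fine (nu (cell w))| <= e.

(** The cells shrinking to p have charge tending to 0. Continuity from above is applied to the two
    Jordan parts, whose difference is the charge. *)
Lemma charge_set1 p : K p -> nu [set p] = 0%E.
Proof.
move=> Kp; have mp := plane_set1_measurable p.
rewrite -[LHS]fineK; last exact: fin_num_measure.
congr EFin; rewrite fine_charge //.
have pn : mass pos (cell (address n p)) - mass neg (cell (address n p)) @[n --> \oo]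
    --> mass pos [set p] - mass neg [set p] by apply: cvgB; exact: mass_set1_cvg.
rewrite -(cvg_lim (@Rhausdorff R) pn); apply: cvg_lim => //; apply/cvgrPdist_le => e e0.
have [m mP] := small_nu e0; exists m => // n /= mn.
rewrite sub0r normrN; have := mP (address n p); rewrite size_address => /(_ mn).
by rewrite fine_charge //; exact: cell_measurable.
Qed.

(** Needed because the Jordan parts evaluate the charge, up to sign, on the intersection of {p} with
    a set of the Hahn decomposition. *)
Lemma charge_sub_set1 A p : K p -> nu ([set p] `&` A) = 0%E.
Proof.
move=> Kp; have [Ap|nAp] := pselect (A p).
  by rewrite (_ : _ `&` _ = [set p]) ?charge_set1 //; apply/seteqP; split=> [x []|x ->].
rewrite (_ : _ `&` _ = set0) ?charge0 //.
by apply/seteqP; split=> x // [-> /nAp].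
Qed.

Lemma atomless_jordan_pos : atomless pos.
Proof.
move=> p Kp; rewrite jordan_posE cjordan_posE /crestr0 mem_set; last first.
  exact: plane_set1_measurable.
exact: charge_sub_set1.
Qed.

Lemma atomless_jordan_neg : atomless neg.
Proof.
move=> p Kp; rewrite jordan_negE cjordan_negE /crestr0 mem_set; last first.
  exact: plane_set1_measurable.
by rewrite /crestr charge_sub_set1 // oppe0.
Qed.

Definition total_mass : R := mass pos K + mass neg K.

Lemma charge_Riemann_dist m w f (c : seq 'I_3 -> R) (e M : R) : 0 <= e ->
  measurable_fun (cell w) f -> (forall x, cell w x -> `|f x| <= M) ->
  (forall v x, size v = m -> cell (w ++ v) x -> `|f x - c v| <= e) ->
  `|charge_integral nu (cell w) f -
    \sum_(v <- words m) c v * fine (nu (cell (w ++ v)))| <= e * total_mass.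
Proof.
move=> e0 mf fM fc; have mw := cell_measurable w.
have fpos := bounded_integrable pos mw mf fM.
have fneg := bounded_integrable neg mw mf fM.
have -> : \sum_(v <- words m) c v * fine (nu (cell (w ++ v))) =
    \sum_(v <- words m) c v * mass pos (cell (w ++ v)) -
    \sum_(v <- words m) c v * mass neg (cell (w ++ v)).
  rewrite -sumrB; apply: eq_bigr => v _; rewrite fine_charge ?mulrBr //.
  exact: cell_measurable.
rewrite /charge_integral.
have dpos := Riemann_dist atomless_jordan_pos fpos fc.
have dneg := Riemann_dist atomless_jordan_neg fneg fc.
have le_K (mu : {finite_measure set (plane R) -> \bar R}) :
    e * mass mu (cell w) <= e * mass mu K.
  by apply: ler_wpM2l => //; apply: le_mass => //;
    [exact: gasket_measurable|exact: cell_gasket].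
have subrACA (a b s t : R) : a - b - (s - t) = (a - s) - (b - t) by ring.
rewrite /total_mass mulrDr subrACA; apply: le_trans (ler_normB _ _) _.
by apply: lerD; [apply: le_trans dpos (le_K _)|apply: le_trans dneg (le_K _)].
Qed.

End charge.
End gasket_measure.

(** * Riemann sums for energy measures *)

Section energy_charge.
Variable R : realType.
Hypothesis attr : is_attractor (@gasket R).
Local Notation K := (@gasket R).
Implicit Types (u f h phi : plane R -> R) (w v : seq 'I_3) (a b c : 'I_3 -> R).

(* Weighting an edge by the mean of c at its end points makes the discrete
   Leibniz rule exact. *)
Definition Et c a b : R :=
  (c ord0 + c 1) / 2 * ((a ord0 - a 1) * (b ord0 - b 1)) +
  (c ord0 + c 2) / 2 * ((a ord0 - a 2) * (b ord0 - b 2)) +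
  (c 1 + c 2) / 2 * ((a 1 - a 2) * (b 1 - b 2)).

Lemma Et_Leibniz c a b : Et c a b + Et b a c = E0 a (fun i => c i * b i).
Proof. by rewrite /Et /E0; field. Qed.

(** On an edge with mean weight m, 2|m s t| <= m^2 s^2 + t^2, and m^2 is at most the mean of the
    squared weights. The right-hand side is thus again of the form [Et], now with weight b^2, and
    its sums converge to an integral against nu_h. *)
Lemma Et_bound c a b : 2 * `|Et b a c| <= Et (fun i => b i * b i) a a + E0 c c.
Proof.
have edge (x y s t : R) : (x + y) / 2 * (s * t) <= ((x * x + y * y) / 2 * (s * s) + t * t) / 2 /\
    - ((x + y) / 2 * (s * t)) <= ((x * x + y * y) / 2 * (s * s) + t * t) / 2.
  have h1 := sqr_ge0 ((x - y) / 2 * s); have h2 := sqr_ge0 ((x + y) / 2 * s - t).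
  have h3 := sqr_ge0 ((x + y) / 2 * s + t).
  split; rewrite -subr_ge0.
    rewrite (_ : _ - _ = (((x - y) / 2 * s) ^+ 2 + ((x + y) / 2 * s - t) ^+ 2) / 2); last by field.
    lra.
  rewrite (_ : _ - _ = (((x - y) / 2 * s) ^+ 2 + ((x + y) / 2 * s + t) ^+ 2) / 2); last by field.
  lra.
have [e1 e2] := edge (b ord0) (b 1) (a ord0 - a 1) (c ord0 - c 1).
have [e3 e4] := edge (b ord0) (b 2) (a ord0 - a 2) (c ord0 - c 2).
have [e5 e6] := edge (b 1) (b 2) (a 1 - a 2) (c 1 - c 2).
rewrite mulrC -ler_pdivlMr // ler_norml /Et /E0; apply/andP; split; lra.
Qed.

Lemma Et_dist c a b (r e : R) : (forall i, `|c i - r| <= e) ->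
  `|Et c a b - r * E0 a b| <= e * ((E0 a a + E0 b b) / 2).
Proof.
move=> cr; have edge (i j : 'I_3) (s t : R) :
    `|((c i + c j) / 2 - r) * (s * t)| <= e * ((s * s + t * t) / 2).
  rewrite normrM; apply: ler_pM => //.
    have := cr i; have := cr j; rewrite !ler_norml => /andP[? ?] /andP[? ?].
    by apply/andP; split; lra.
  have h1 := sqr_ge0 (s - t); have h2 := sqr_ge0 (s + t).
  rewrite expr2 in h1; rewrite expr2 in h2.
  by rewrite ler_norml; apply/andP; split; lra.
rewrite (_ : Et c a b - _ =
  ((c ord0 + c 1) / 2 - r) * ((a ord0 - a 1) * (b ord0 - b 1)) +
  ((c ord0 + c 2) / 2 - r) * ((a ord0 - a 2) * (b ord0 - b 2)) +
  ((c 1 + c 2) / 2 - r) * ((a 1 - a 2) * (b 1 - b 2))); last by rewrite /Et /E0; ring.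
apply: le_trans (ler_normD _ _) _; apply: le_trans (lerD (ler_normD _ _) (lexx _)) _.
apply: le_trans (lerD (lerD (edge _ _ _ _) (edge _ _ _ _)) (edge _ _ _ _)) _.
by rewrite /E0; lra.
Qed.

Lemma E0_bound a b (r s : R) : (forall i j, `|a i - a j| <= r) ->
  (forall i j, `|b i - b j| <= s) -> `|E0 a b| <= 3 * (r * s).
Proof.
move=> ar bs; have edge i j k l : `|(a i - a j) * (b k - b l)| <= r * s.
  by rewrite normrM; exact: ler_pM.
apply: le_trans (ler_normD _ _) _; apply: le_trans (lerD (ler_normD _ _) (lexx _)) _.
apply: le_trans (lerD (lerD (edge _ _ _ _) (edge _ _ _ _)) (edge _ _ _ _)) _; lra.
Qed.

Lemma continuous_cell_osc w f (e : R) : {within cell w, continuous f} -> 0 < e ->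
  exists m, forall v x y, (m <= size v)%N -> cell (w ++ v) x -> cell (w ++ v) y ->
    `|f x - f y| <= e.
Proof.
move=> cf e0.
have [d d0 dP] := compact_uniformly_continuous (@compact_cell R attr w) cf e0.
have [m mP] := small_cells attr d0; exists m => v x y mv vx vy.
apply/ltW/dP; [exact: sub_cell_cat vx|exact: sub_cell_cat vy|].
by apply: (mP (w ++ v)) => //; rewrite size_cat (leq_trans mv) // leq_addl.
Qed.

Lemma continuous_cell_bounded w f : {within cell w, continuous f} ->
  exists M, forall x, cell w x -> `|f x| <= M.
Proof.
move=> cf; have /compact_bounded[M [_ MP]] := continuous_compact cf (@compact_cell R attr w).
by exists (M + 1) => x wx; apply: MP; [rewrite ltrDl|exists x].
Qed.

Lemma CK_cell w f : CK f -> {within cell w, continuous f}.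
Proof. by apply: continuous_subspaceW; exact: cell_gasket. Qed.

Section charge.
Variables (h phi : plane R -> R) (nu : {charge set (plane R) -> \bar R}).
Hypothesis hh : vharmonic h.
Hypothesis hF : domF h.
Hypothesis phiF : domF phi.
Hypothesis nuE : forall w, nu (cell w) = (cell_energy w h phi)%:E.

Lemma fine_nu_cell w : fine (nu (cell w)) = rfac R ^- size w * E0 (vals h w) (vals phi w).
Proof. by rewrite nuE cell_energy_vharmonic. Qed.

Lemma vals_osc : exists M, forall i j, `|vals h [::] i - vals h [::] j| <= M.
Proof. by exists (osc (vals h [::])) => i j; exact: le_osc. Qed.

(** The oscillation of [h] on a cell of level n is O(r^n), which cancels r^{-n}. What remains is the
    oscillation of [phi], small by uniform continuity. *)
Lemma energy_charge_small (e : R) : 0 < e -> exists m, forall w, (m <= size w)%N ->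
  `|fine (nu (cell w))| <= e.
Proof.
move=> e0; have [M MP] := vals_osc; have M0 : 0 <= M by exact: le_trans (MP ord0 ord0).
(* The 3 counts the edges of a cell; M + 1 instead of M covers the case M = 0. *)
have e'0 : 0 < e / (3 * (M + 1)) by rewrite divr_gt0 // mulr_gt0 //; lra.
have [phiC _] := phiF.
have [m mP] := continuous_cell_osc (@CK_cell [::] _ phiC) e'0.
exists m => w mw; rewrite fine_nu_cell normrM gtr0_norm ?rfacVX_gt0 //.
have := E0_bound (vharmonic_osc hh MP w) (fun i j => mP w (Fw w (q R i)) (Fw w (q R j))
   mw (cell_q attr w i) (cell_q attr w j)).
set s := rfac R ^+ size w => H.
have s0 : 0 < s by rewrite exprn_gt0 // rfac_gt0.
rewrite mulrC ler_pdivrMr //; apply: le_trans H _.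
rewrite (_ : 3 * _ = e * s * (M / (M + 1))).
  by rewrite ler_piMr ?mulr_ge0 ?(ltW e0) ?(ltW s0) // ler_pdivrMr ?mul1r; lra.
by field; apply/eqP; lra.
Qed.

Definition Riemann_sum w f m : R := rfac R ^- (size w + m) *
  \sum_(v <- words m) Et (vals f (w ++ v)) (vals h (w ++ v)) (vals phi (w ++ v)).

Lemma sum_E0_le u M w m : energy_le u M ->
  rfac R ^- (size w + m) * \sum_(v <- words m) E0 (vals u (w ++ v)) (vals u (w ++ v)) <= M.
Proof.
move=> uM; apply: le_trans (uM (size w + m)%N).
rewrite /En sum_words_cat; apply: ler_wpM2l; first exact/ltW/rfacVX_gt0.
rewrite [leRHS](bigD1_seq w) ?uniq_words ?mem_words //= lerDl.
by apply: sumr_ge0 => v _; apply: sumr_ge0 => v' _; exact: E0_ge0.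
Qed.

(** The comparison goes through the sum of sampled values of [f] times the charges of the subcells.
    Its distance to the integral is controlled by the total variation, its distance to the edge sum
    by the energies of [h] and [phi]. *)
Lemma Riemann_sum_cvg w f : {within cell w, continuous f} ->
  Riemann_sum w f m @[m --> \oo] --> charge_integral nu (cell w) f.
Proof.
move=> cf; have [M fM] := continuous_cell_bounded cf.
have mf := continuous_plane_measurable (cell_measurable attr w) cf.
have [_ [Mh hM]] := (domFP attr h).1 hF; have [_ [Mp pM]] := (domFP attr phi).1 phiF.
(* The first summand pays for the integral and the second for the edge sum, where |st| <= (s^2 +
   t^2)/2 splits each edge product. *)
pose C := total_mass nu + (Mh + Mp) / 2.
have C0 : 0 <= C.
  have := energy_le_ge0 hM; have := energy_le_ge0 pM.
  have := mass_ge0 (jordan_pos (hahnP nu)) K; have := mass_ge0 (jordan_neg (hahnP nu)) K.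
  by rewrite /C /total_mass; lra.
apply/cvgrPdist_le => e e0.
have e'0 : 0 < e / (C + 1) by rewrite divr_gt0 //; lra.
have [m mP] := continuous_cell_osc cf e'0; exists m => // n /= mn.
pose c v := f (Fw (w ++ v) (q R ord0)); pose e' := e / (C + 1).
have fc v x : size v = n -> cell (w ++ v) x -> `|f x - c v| <= e'.
  by move=> vn vx; apply: (mP v) => //; [rewrite vn|exact: cell_q].
have H1 := charge_Riemann_dist attr energy_charge_small (ltW e'0) mf fM fc.
have H2 : `|\sum_(v <- words n) c v * fine (nu (cell (w ++ v))) - Riemann_sum w f n| <=
    e' * ((Mh + Mp) / 2).
  rewrite distrC /Riemann_sum mulr_sumr -sumrB.
  apply: le_trans (ler_norm_sum _ _ _) _.
  apply: (@le_trans _ _ (\sum_(v <- words n) rfac R ^- (size w + n) *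
     (e' * ((E0 (vals h (w ++ v)) (vals h (w ++ v)) +
             E0 (vals phi (w ++ v)) (vals phi (w ++ v))) / 2)))).
    rewrite big_seq [leRHS]big_seq; apply: ler_sum => v; rewrite mem_words => /eqP vn.
    rewrite fine_nu_cell size_cat vn mulrCA -mulrBr normrM gtr0_norm ?rfacVX_gt0 //.
    apply: ler_wpM2l; first exact/ltW/rfacVX_gt0.
    by apply: Et_dist => i; apply: fc => //; exact: cell_q.
  have := sum_E0_le w n hM; have := sum_E0_le w n pM.
  rewrite !mulr_sumr => p1 p2.
  apply: (@le_trans _ _ (e' * ((\sum_(v <- words n) rfac R ^- (size w + n) *
      E0 (vals h (w ++ v)) (vals h (w ++ v)) +
    \sum_(v <- words n) rfac R ^- (size w + n) * E0 (vals phi (w ++ v)) (vals phi (w ++ v))) / 2))).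
    rewrite -big_split mulr_suml mulr_sumr le_eqVlt; apply/orP; left; apply/eqP.
    by apply: eq_bigr => v _; rewrite /=; ring.
  by apply: ler_wpM2l; [exact: ltW|lra].
have -> : e = e' * (C + 1) by rewrite /e' divfK //; apply/eqP; lra.
have := ler_distD (\sum_(v <- words n) c v * fine (nu (cell (w ++ v))))
  (charge_integral nu (cell w) f) (Riemann_sum w f n).
move=> /le_trans; apply; apply: le_trans (lerD H1 H2) _.
by rewrite -mulrDr -/C; apply: ler_wpM2l; [exact: ltW|lra].
Qed.

End charge.
End energy_charge.

(** * Integration by parts on a single cell *)

Section cell_form.
Variable R : realType.
Hypothesis attr : is_attractor (@gasket R).
Local Notation K := (@gasket R).
Implicit Types (u f h phi : plane R -> R) (w v : seq 'I_3) (a b c : 'I_3 -> R).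

Lemma En_energy_cvg u : domF u -> En n u u @[n --> \oo] --> energy u u.
Proof.
move=> /(domFP attr)[_ [M uM]]; rewrite (energyE attr).
apply: (@nondecreasing_is_cvgn _ (fun n => En n u u)).
  by apply/nondecreasing_seqP => n; exact: En_mono.
by exists M => _ [n _ <-].
Qed.

Lemma energy_le_energy u : domF u -> energy_le u (energy u u).
Proof.
move=> uF n; have cu := En_energy_cvg uF; rewrite -(cvg_lim (@Rhausdorff R) cu).
apply: (@nondecreasing_cvgn_le _ (fun n => En n u u)).
  by apply/nondecreasing_seqP => m; exact: En_mono.
by apply/cvg_ex; exists (energy u u).
Qed.

Lemma cell_energy_ge0 w u : domF (u \o Fw w) -> 0 <= cell_energy w u u.
Proof.
move=> /energy_le_energy/energy_le_ge0 u0.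
by apply: mulr_ge0 => //; exact/ltW/rfacVX_gt0.
Qed.

(** The negative Jordan part is minus the charge on the negative Hahn set. It vanishes since the
    charge agrees with a measure, so the positive part is that measure. *)
Lemma charge_integral_measure (nu : {charge set (plane R) -> \bar R})
    (mu : {finite_measure set (plane R) -> \bar R}) D f (M : R) :
  (forall A, measurable A -> mu A = nu A) ->
  measurable D -> measurable_fun D f -> (forall x, D x -> `|f x| <= M) ->
  charge_integral nu D f = \int[mu]_(x in D) f x.
Proof.
move=> munu mD mf fM.
have neg0 A : measurable A -> jordan_neg (hahnP nu) A = 0%E.
  move=> mA; apply/eqP; rewrite eq_le measure_ge0 andbT.
  rewrite jordan_negE cjordan_negE /crestr0 mem_set // /crestr leeNl oppe0.
  have mN : measurable (hahn_neg nu) by case: (hahnP nu) => _ [].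
  by rewrite -munu ?measure_ge0 //; exact: measurableI.
have posE A : measurable A -> A `<=` D -> jordan_pos (hahnP nu) A = mu A.
  move=> mA _; rewrite munu // (jordan_decomp (hahnP nu) mA).
  have -> : cadd (jordan_pos (hahnP nu)) (cscale (-1) (jordan_neg (hahnP nu))) A =
      (jordan_pos (hahnP nu) A - jordan_neg (hahnP nu) A)%E.
    by rewrite /cadd /= cscaleN1.
  by rewrite neg0 // oppe0 adde0.
rewrite /charge_integral (Rintegral_null mD mf (neg0 D mD)) subr0.
by rewrite /Rintegral; congr fine; apply: eq_measure_integral.
Qed.

Variables (h phi : plane R -> R) (nuhp : {charge set (plane R) -> \bar R}).
Variable nuhh : {charge set (plane R) -> \bar R}.
Hypothesis hh : vharmonic h.
Hypothesis hF : domF h.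
Hypothesis phiF : domF phi.
Hypothesis nuhpE : forall w, nuhp (cell w) = (cell_energy w h phi)%:E.
Hypothesis nuhhE : forall w, nuhh (cell w) = (cell_energy w h h)%:E.

(** The right-hand side does not involve m: in the discrete Leibniz rule the boundary term is
    therefore exact at every level, not only in the limit. *)
Lemma sum_E0_vharmonic w m u :
  rfac R ^- (size w + m) * \sum_(v <- words m) E0 (vals h (w ++ v)) (vals u (w ++ v)) =
  rfac R ^- size w * E0 (vals h w) (vals u w).
Proof.
have := En_vharmonic m (u \o Fw w) (vharmonic_comp w hh).
rewrite !vals_comp cats0 => <-; rewrite exprD invfM -mulrA /En.
by congr (_ * (_ * _)); apply: eq_bigr => v _; rewrite !vals_comp.
Qed.

(* On a cell, f dnu_{h,phi} is a boundary term minus phi dnu_{h,f}, and the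
   latter is controlled by phi^2 dnu_h and the energy of f. *)
Lemma cell_integral_bound w f : {within cell w, continuous f} ->
  domF (f \o Fw w) ->
  2 * `|charge_integral nuhp (cell w) f -
        rfac R ^- size w * E0 (vals h w) (vals (fun x => f x * phi x) w)| <=
  charge_integral nuhh (cell w) (fun x => phi x * phi x) + cell_energy w f f.
Proof.
move=> cf fF; set B := rfac R ^- size w * _.
have phiC : {within cell w, continuous phi} by apply: (@CK_cell R attr w phi); case: phiF.
have p2C : {within cell w, continuous (fun x => phi x * phi x)}.
  by move=> x; apply: cvgM; exact: phiC.
have c1 := Riemann_sum_cvg attr hh hF phiF nuhpE cf.
have c2 := Riemann_sum_cvg attr hh hF hF nuhhE p2C.
have c1B : Riemann_sum h phi w f m - B @[m --> \oo] -->
    charge_integral nuhp (cell w) f - B by apply: cvgB; [exact: c1|exact: cvg_cst].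
have c1n : 2 * `|Riemann_sum h phi w f m - B| @[m --> \oo] -->
    2 * `|charge_integral nuhp (cell w) f - B|.
  by apply: cvgMr; exact: (cvg_norm c1B).
have c2D : Riemann_sum h h w (fun x => phi x * phi x) m + cell_energy w f f
    @[m --> \oo] --> charge_integral nuhh (cell w) (fun x => phi x * phi x) +
    cell_energy w f f by apply: cvgD; [exact: c2|exact: cvg_cst].
apply: (ler_cvg_to c1n c2D).
apply: nearW => m.
have -> : Riemann_sum h phi w f m - B = - (rfac R ^- (size w + m) *
   \sum_(v <- words m) Et (vals phi (w ++ v)) (vals h (w ++ v)) (vals f (w ++ v))).
  rewrite /B -(sum_E0_vharmonic w m) /Riemann_sum -mulrBr -sumrB -mulrN -sumrN.
  congr (_ * _); apply: eq_bigr => v _.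
  have fphi := Et_Leibniz (vals f (w ++ v)) (vals h (w ++ v)) (vals phi (w ++ v)).
  apply/eqP; rewrite subr_eq addrC -subr_eq opprK; apply/eqP; exact: fphi.
rewrite normrN normrM gtr0_norm ?rfacVX_gt0 // mulrCA.
have le_f : rfac R ^- (size w + m) *
    \sum_(v <- words m) E0 (vals f (w ++ v)) (vals f (w ++ v)) <= cell_energy w f f.
  rewrite exprD invfM -mulrA; apply: ler_wpM2l; first exact/ltW/rfacVX_gt0.
  apply: le_trans (energy_le_energy fF m); rewrite /En.
  by under [in leRHS]eq_bigr do rewrite !vals_comp.
apply: le_trans (lerD (lexx _) le_f); rewrite /Riemann_sum -mulrDr.
apply: ler_wpM2l; first exact/ltW/rfacVX_gt0.
rewrite -big_split; apply: le_trans (ler_wpM2l _ (ler_norm_sum _ _ _)) _ => //.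
by rewrite mulr_sumr; apply: ler_sum => v _; exact: Et_bound.
Qed.

End cell_form.

(** * The two halves *)

Section halves.
Variable R : realType.
Hypothesis attr : is_attractor (@gasket R).
Local Notation K := (@gasket R).
Implicit Types (u f h phi : plane R -> R) (w v : seq 'I_3) (i j : 'I_3).

(* The words of W_L are the chain n 1 and those of W_R the chain n 2. *)
Definition chain n i : seq 'I_3 := rcons (nseq n ord0) i.

Lemma W_chain n i : W_ i (chain n i). Proof. by exists n. Qed.

Lemma chain0 n : chain n ord0 = nseq n.+1 ord0.
Proof. by rewrite /chain -cats1 -(addn1 n) nseqD. Qed.

Lemma Fw_chain n i x : Fw (chain n i) x = Fw (nseq n ord0) (F_ i x) :> plane R.
Proof. by rewrite /chain -cats1 Fw_cat. Qed.

(** For i = 1, 2 these points descend from q_i along a side of the triangle towards q_0; the cells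
    [chain n i] and [chain n.+1 i] share the point of index n + 1. *)
Definition junction i n : plane R := Fw (nseq n ord0) (q R i).

Lemma Fw_chain_q i n : Fw (chain n i) (q R i) = junction i n.
Proof. by rewrite Fw_chain F_fix. Qed.

Lemma Fw_chain_q0 i n : Fw (chain n i) (q R ord0) = junction i n.+1.
Proof. by rewrite Fw_chain F_q -Fw_chain chain0. Qed.

Lemma junction_dist i n : `|q R ord0 - junction i n| = 2^-1 ^+ n * `|q R ord0 - q R i|.
Proof. by rewrite -{1}(Fw_nseq_q R n ord0) Fw_dist size_nseq. Qed.

Lemma junction_cvg phi i : CK phi -> phi (junction i n) @[n --> \oo] --> phi (q R ord0).
Proof.
move=> phiC; apply/cvgrPdist_lt => e e0.
have [d d0 dP] := (CKP phi).1 phiC _ (gasket_q attr ord0) e e0.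
have [m md] := expr2_lt `|q R ord0 - q R i| d0; exists m => // n /= mn.
apply: dP; first exact/gasket_Fw/gasket_q.
rewrite junction_dist; apply: le_lt_trans md; apply: ler_wpM2r => //.
by rewrite ler_wiXn2l // invf_le1 // ler1n.
Qed.

(** Each passage to the topmost subcell multiplies the drop below h(q_0) = 1 by 3/5. *)
Lemma vals_chain h n : vharmonic h -> h (q R ord0) = 1 -> h (q R 1) = 0 -> h (q R 2) = 0 ->
  vals h (nseq n ord0) = fun k => if k == ord0 then 1 else 1 - rfac R ^+ n.
Proof.
move=> hh h0 h1 h2; elim: n => [|n IH].
  by apply/funext; elim/ord3P; rewrite /vals /= ?expr0 ?subrr.
apply/funext => k; rewrite -chain0 hh IH /hext sum3 exprS /rfac.
by elim/ord3P: k => //=; field.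
Qed.

(* By symmetry h has no normal derivative at the vertex on the axis, and the
   other two normal derivatives are 1 and -1 for every n. *)
Lemma chain_boundary h n i (b : 'I_3 -> R) : i != ord0 -> vharmonic h ->
  h (q R ord0) = 1 -> h (q R 1) = 0 -> h (q R 2) = 0 ->
  rfac R ^- size (chain n i) * E0 (vals h (chain n i)) b = b ord0 - b i.
Proof.
move=> i0 hh h0 h1 h2; rewrite size_rcons size_nseq.
have hE j : vals h (chain n i) j = hext (vals h (nseq n ord0)) i j := hh _ _ _.
rewrite /E0 !hE (vals_chain n hh h0 h1 h2) /hext sum3 exprS.
have : rfac R ^+ n != 0 by rewrite expf_neq0 // gt_eqF // rfac_gt0.
rewrite /rfac; move: (_ ^+ n) => t t0.
by elim/ord3P: i i0 {hE} => //= _; field.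
Qed.

Lemma bary_nseq n j x : j != ord0 -> bary j (Fw (nseq n ord0) x) = bary j x / 2 ^+ n :> R.
Proof.
move=> /negbTE j0; elim: n => [|n IH] /=; first by rewrite expr0 divr1.
by rewrite bary_F j0 addr0 IH exprS invfM -mulrA (mulrC _ 2^-1).
Qed.

(** F_0 halves both coordinates 1 and 2, so it suffices to compare them on F_i(K), where coordinate
    i is at least 1/2 and coordinate j at most 1/2. *)
Lemma chain_side n i j x : i != ord0 -> j != ord0 -> i != j -> cell (chain n i) x ->
  bary j x <= bary i x :> R.
Proof.
move=> i0 j0 ij [y Ky <-]; rewrite Fw_chain !bary_nseq // ler_pM2r ?invr_gt0 ?exprn_gt0 //.
have ji : j != i by rewrite eq_sym.
exact: le_trans (bary_F_le attr ji Ky) (bary_F_ge attr i Ky).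
Qed.

(** Equality forces both coordinates of the point of F_i(K) to be 1/2, so its preimage has j-th
    coordinate 1. Each cell of the chain thus touches the axis in one corner only. *)
Lemma chain_axis n i j x : i != ord0 -> j != ord0 -> i != j -> cell (chain n i) x ->
  bary j x = bary i x :> R -> x = Fw (chain n i) (q R j).
Proof.
move=> i0 j0 ij [y Ky <-]; rewrite Fw_chain !bary_nseq //.
have n0 : (2 ^+ n)^-1 != 0 :> R by rewrite invr_neq0 // expf_neq0.
move=> /(mulIf n0) bij; have ji : j != i by rewrite eq_sym.
have := bary_F_le attr ji Ky; have := bary_F_ge attr i Ky.
rewrite -bij bary_F (negbTE ji) /= => ? ?.
rewrite [y in Fw _ (F_ i y)](_ : y = q R j) ?Fw_chain //; apply: bary_eq1 => //; lra.
Qed.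

Lemma fst_side x : x.1 - 2^-1 = (bary 2 x - bary 1 x) / 2 :> R.
Proof. by rewrite fst_bary; have := sum_bary x; lra. Qed.

Lemma half1_le x : half_gasket 1 x -> x.1 <= 2^-1 :> R.
Proof.
by move=> [_ [n _ <-] /(@chain_side n 1 2 x isT isT isT)]; have := fst_side x; lra.
Qed.

Lemma half2_ge x : half_gasket 2 x -> 2^-1 <= x.1 :> R.
Proof.
by move=> [_ [n _ <-] /(@chain_side n 2 1 x isT isT isT)]; have := fst_side x; lra.
Qed.

Lemma half_gasketE i x : half_gasket i x <-> exists n, cell (chain n i) (x : plane R).
Proof.
split=> [[_ [n _ <-] nx]|[n nx]]; first by exists n.
by exists (chain n i) => //; exact: W_chain.
Qed.

Lemma cell_nseqS n x : cell (nseq n ord0) (x : plane R) <->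
  [\/ cell (nseq n.+1 ord0) x, cell (chain n 1) x | cell (chain n 2) x].
Proof.
rewrite (cell_rcons attr) -chain0; split=> [[i _]|].
  by elim/ord3P: i => ?; [constructor 1|constructor 2|constructor 3].
by case=> ?; [exists ord0|exists 1|exists 2].
Qed.

(** A point outside both halves survives every splitting of the topmost cell, and the cells F_0^n(K)
    shrink to q_0. *)
Lemma gasket_halves x : K x -> [\/ x = q R ord0, half_gasket 1 x | half_gasket 2 x].
Proof.
move=> Kx; have [?|n1] := pselect (half_gasket 1 x); first by constructor 2.
have [?|n2] := pselect (half_gasket 2 x); first by constructor 3.
constructor 1; have xn n : cell (nseq n ord0) x.
  elim: n => [|n IH]; first by rewrite cell_nil.
  by case/cell_nseqS: IH => // nx; exfalso; [apply: n1|apply: n2];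
    apply/half_gasketE; exists n.
apply/eqP/negPn/negP => xq; have e0 : 0 < `|x - q R ord0| by rewrite normr_gt0 subr_eq0.
have [m mP] := small_cells attr e0.
have := mP (nseq m ord0) x (q R ord0); rewrite size_nseq leqnn ltxx => /(_ isT (xn m)).
have := cell_q attr (nseq m ord0) ord0; rewrite Fw_nseq_q => qm /(_ qm).
by [].
Qed.

Section half_function.
Variables (i : 'I_3) (u : plane R -> R).
Hypothesis uD : half_dom i u.

Definition half_energy : R := fine (\esum_(w in W_ i) (cell_energy w u u)%:E)%E.

Lemma chain_domF n : domF (u \o Fw (chain n i)).
Proof. by have [_ + _] := uD; apply; exact: W_chain. Qed.

Lemma sum_chain_energy N :
  \sum_(n < N) cell_energy (chain n i) u u <= half_energy.
Proof.
have [_ uW uE] := uD; pose S := (\esum_(w in W_ i) (cell_energy w u u)%:E)%E.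
have chain_inj : injective (chain ^~ i).
  by move=> m n /(congr1 size); rewrite !size_rcons !size_nseq => -[].
have : ((\sum_(n < N) cell_energy (chain n i) u u)%:E <= S)%E.
  rewrite -sumEFin; apply: ereal_sup_ubound => /=.
  exists [set` [seq chain n i | n <- index_iota 0 N]].
    split; first exact: finite_seq.
    by move=> _ /= /mapP[n _ ->]; exact: W_chain.
  rewrite -fsbig_seq; last by rewrite map_inj_uniq ?iota_uniq.
  by rewrite big_map big_mkord.
have S0 : (0 <= S)%E.
  by apply: esum_ge0 => w Ww; rewrite lee_fin (cell_energy_ge0 attr) //; exact: uW.
by rewrite -lee_fin fineK // ge0_fin_numE.
Qed.

Lemma half_energy_ge0 : 0 <= half_energy.
Proof. by have := sum_chain_energy 0; rewrite big_ord0. Qed.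

Lemma chain_osc n x : K x ->
  `|u (Fw (chain n i) x) - u (junction i n.+1)| <= (4 / 5) ^+ n * (16 * half_energy + 1).
Proof.
move=> Kx; rewrite -Fw_chain_q0; have fF := chain_domF n.
have := energy_le_osc attr fF.1 (energy_le_energy attr fF) Kx.
have E1 : cell_energy (chain n i) u u <= half_energy.
  apply: le_trans (sum_chain_energy n.+1); rewrite big_ord_recr /= lerDr.
  by apply: sumr_ge0 => k _; exact: (cell_energy_ge0 attr (chain_domF k)).
have : energy (u \o Fw (chain n i)) (u \o Fw (chain n i)) <= rfac R ^+ n.+1 * half_energy.
  by move: E1; rewrite /cell_energy size_rcons size_nseq ler_pdivrMl ?exprn_gt0 ?rfac_gt0.
move: (energy _ _) => e eE /= ue.
(* 3/5 <= (4/5)^2 replaces a square root of 3/5 by a rational rate. *)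
have r45 : rfac R ^+ n.+1 <= ((4 / 5) ^+ n) ^+ 2.
  rewrite exprAC exprS; apply: (@le_trans _ _ (rfac R ^+ n)).
    by rewrite ler_piMl ?exprn_ge0 ?ltW ?rfac_gt0 // /rfac; lra.
  by apply: lerXn2r; rewrite ?nnegrE /rfac; lra.
have H0 := half_energy_ge0; have s0 : 0 <= (4 / 5 : R) ^+ n by rewrite exprn_ge0.
have b0 : 0 <= (4 / 5) ^+ n * (16 * half_energy + 1).
  by rewrite mulr_ge0 // addr_ge0 // mulr_ge0.
rewrite -(@ler_pXn2r _ 2) ?nnegrE // -normrX ger0_norm ?sqr_ge0 //.
apply: le_trans ue _; rewrite exprMn.
apply: (@le_trans _ _ (((4 / 5) ^+ n) ^+ 2 * (16 * half_energy))).
  rewrite mulrCA; apply: ler_wpM2l => //; apply: le_trans eE _.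
  exact: ler_wpM2r.
(* The summand 1 serves here: (16H + 1)^2 >= 16H for H >= 0, without a square root of H. *)
by apply: ler_wpM2l; rewrite ?sqr_ge0 //; nra.
Qed.

(** The half misses q_0 and is not compact, so the decay of [chain_osc] is summed along the
    junctions: 5 is the sum of the powers of 4/5, and 6 adds the oscillation inside the last
    cell. *)
Lemma half_bounded : exists2 M, 0 <= M & forall x, half_gasket i x -> `|u x| <= M.
Proof.
pose B := 16 * half_energy + 1; have B0 : 0 <= B.
  by rewrite addr_ge0 // mulr_ge0 // half_energy_ge0.
have jn n : `|u (junction i n) - u (junction i 0)| <= 5 * (1 - (4 / 5) ^+ n) * B.
  elim: n => [|n IH]; first by rewrite subrr normr0 expr0 subrr mulr0 mul0r.
  have := chain_osc n (gasket_q attr i); rewrite Fw_chain_q => H.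
  apply: le_trans (ler_distD (u (junction i n)) _ _) _.
  rewrite distrC; apply: le_trans (lerD H IH) _; rewrite -/B exprS; lra.
exists (`|u (junction i 0)| + 6 * B); first by rewrite addr_ge0 // mulr_ge0.
move=> x /half_gasketE[n [y Ky <-]].
have := chain_osc n Ky; have := jn n.+1; rewrite -/B.
move: (u (Fw _ _)) (u (junction i n.+1)) (u (junction i 0)) => a b c bc ab.
have s0 : 0 <= (4 / 5 : R) ^+ n by rewrite exprn_ge0.
have s1 : (4 / 5 : R) ^+ n <= 1 by rewrite exprn_ile1 //; lra.
have := ler_normD (a - c) c; rewrite subrK; have := ler_distD b a c.
rewrite exprS in bc; nra.
Qed.

End half_function.
End halves.

(** * Gluing and cutting off *)

Section gluing.
Variable R : realType.
Hypothesis attr : is_attractor (@gasket R).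
Local Notation K := (@gasket R).
Implicit Types (D N : set (plane R)) (u f g h phi : plane R -> R).
Implicit Types (w v : seq 'I_3) (i j : 'I_3).

Lemma Rintegral_eq_null (mu : {finite_measure set (plane R) -> \bar R}) D N f g :
  measurable D -> measurable N -> mu N = 0%E ->
  mu.-integrable D (EFin \o f) -> mu.-integrable D (EFin \o g) ->
  (forall x, D x -> ~ N x -> f x = g x) ->
  \int[mu]_(x in D) f x = \int[mu]_(x in D) g x.
Proof.
move=> mD mN N0 fi gi fg; rewrite /Rintegral; congr fine.
rewrite (negligible_integral mN mD fi N0) (negligible_integral mN mD gi N0).
by apply: eq_integral => x /set_mem[Dx nNx] /=; rewrite fg.
Qed.

Section charge.
Variable nu : {charge set (plane R) -> \bar R}.
Hypothesis small_nu : forall e : R, 0 < e -> exists m, forall w, (m <= size w)%N ->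
  `|fine (nu (cell w))| <= e.
Let pos0 := atomless_jordan_pos attr small_nu.
Let neg0 := atomless_jordan_neg attr small_nu.

Lemma charge_integral_cell_rcons w f (M : R) : measurable_fun (cell w) f ->
  (forall x, cell w x -> `|f x| <= M) ->
  charge_integral nu (cell w) f = \sum_(i < 3) charge_integral nu (cell (rcons w i)) f.
Proof.
move=> mf fM; have mw := cell_measurable attr w; rewrite /charge_integral sumrB.
by congr (_ - _); apply: (Rintegral_cell_rcons attr) => //; exact: bounded_integrable fM.
Qed.

Lemma charge_integral_eq_set1 D f g p (M : R) : measurable D -> K p ->
  measurable_fun D f -> measurable_fun D g ->
  (forall x, D x -> `|f x| <= M) -> (forall x, D x -> `|g x| <= M) ->
  (forall x, D x -> x <> p -> f x = g x) ->
  charge_integral nu D f = charge_integral nu D g.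
Proof.
move=> mD Kp mf mg fM gM fg; rewrite /charge_integral.
by congr (_ - _); apply: (@Rintegral_eq_null _ _ [set p]) => //;
  [exact: plane_set1_measurable|exact: pos0|
   exact: bounded_integrable fM|exact: bounded_integrable gM|
   exact: plane_set1_measurable|exact: neg0|
   exact: bounded_integrable fM|exact: bounded_integrable gM].
Qed.

(** The cells F_0^n(K) shrink to q_0, which carries no mass for either Jordan part. *)
Lemma charge_integral_tail_cvg f (M : R) : 0 <= M -> measurable_fun K f ->
  (forall x, K x -> `|f x| <= M) ->
  charge_integral nu (cell (nseq n ord0)) f @[n --> \oo] --> 0.
Proof.
move=> M0 mf fM.
have aE n : address n (q R ord0) = nseq n ord0.
  by elim: n => //= n IH; rewrite digit_q -[in F_inv _ _](F_fix R ord0) F_K IH.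
have Kq := gasket_q attr ord0.
have cvg0 (mu : {finite_measure set (plane R) -> \bar R}) : atomless mu ->
    \int[mu]_(x in cell (nseq n ord0)) f x @[n --> \oo] --> 0.
  move=> mu0; have := mass_set1_cvg attr (mu := mu) Kq.
  rewrite {2}/mass (mu0 _ Kq) /= => mc.
  have : M * mass mu (cell (address n (q R ord0))) @[n --> \oo] --> M * 0.
    by apply: cvgMr; exact: mc.
  rewrite mulr0 => /cvgrPdist_le Mc; apply/cvgrPdist_le => e e0.
  have := Mc e e0; apply: filterS => n; rewrite !sub0r !normrN aE => H.
  have mc' := cell_measurable attr (nseq n ord0).
  have sub := @cell_gasket R attr (nseq n ord0).
  have fi : mu.-integrable (cell (nseq n ord0)) (EFin \o f).
    by apply: (@bounded_integrable _ _ _ _ _ _ M) => //;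
      [exact: measurable_funS (gasket_measurable attr) sub mf|move=> x /sub; exact: fM].
  apply: le_trans H; apply: le_trans (ler_norm _).
  have := @Rintegral_dist _ _ _ mu _ f (cst 0) M mc' fi.
  rewrite Rintegral_cst // mul0r subr0; apply.
    exact: finite_measure_integrable_cst.
  by move=> x /sub Kx; rewrite subr0 fM.
rewrite -[X in _ --> X](subr0 0) /charge_integral.
by apply: cvgB; apply: cvg0; [exact: pos0|exact: neg0].
Qed.

(** The exceptional set has to be null for all atomless measures because both Jordan parts of the
    charge are used. *)
Lemma charge_integral_bounded_convergence (f_ : nat -> plane R -> R) f (M : R) N :
  (forall n, measurable_fun K (f_ n)) -> measurable_fun K f -> measurable N ->
  (forall mu : {finite_measure set (plane R) -> \bar R}, atomless mu -> mu N = 0%E) ->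
  (forall x, K x -> ~ N x -> f_ n x @[n --> \oo] --> f x) ->
  (forall n x, K x -> `|f_ n x| <= M) ->
  charge_integral nu K (f_ n) @[n --> \oo] --> charge_integral nu K f.
Proof.
move=> mf_ mf mN N0 f_f f_M; have mK := gasket_measurable attr.
by apply: cvgB; apply: (bounded_convergence _ _ _ mN _ f_f f_M) => //; apply: N0;
  [exact: pos0|exact: neg0].
Qed.

End charge.

(** Only the topmost cell is split, again and again: its two lower children join the chains and its
    upper child is split next. *)
Lemma chain_decomposition (J : seq 'I_3 -> R) (N : nat) :
  (forall w, J w = \sum_(i < 3) J (rcons w i)) ->
  J [::] = J (nseq N ord0) + \sum_(n < N) (J (chain n 1) + J (chain n 2)).
Proof.
move=> JE; elim: N => [|N ->]; first by rewrite big_ord0 addr0.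
by rewrite JE sum3 -/(chain N ord0) chain0 big_ord_recr /=; ring.
Qed.

Lemma half_gasket_measurable i : measurable (half_gasket i : set (plane R)).
Proof.
rewrite (_ : half_gasket i = \bigcup_n cell (chain n i)).
  by apply: bigcupT_measurable => n; exact: cell_measurable.
apply/seteqP; split=> x; first by move=> /half_gasketE[n nx]; exists n.
by move=> [n _ nx]; apply/half_gasketE; exists n.
Qed.

Definition axis : set (plane R) := K `&` [set x | x.1 = 2^-1].

(** By [chain_axis] each cell of the chains contributes one point, so the axis is countable and null
    for every atomless measure. *)
Lemma axisP x : axis x -> x = q R ord0 \/
  exists n, x = Fw (chain n 1) (q R 2) \/ x = Fw (chain n 2) (q R 1).
Proof.
move=> [Kx /= x1]; have := fst_side x; rewrite x1 subrr => b12.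
have bE : bary 2 x = bary 1 x by lra.
case: (gasket_halves attr Kx) => [->|/half_gasketE[n nx]|/half_gasketE[n nx]].
- by left.
- by right; exists n; left; exact: (chain_axis attr _ _ _ nx bE).
- by right; exists n; right; exact: (chain_axis attr _ _ _ nx (esym bE)).
Qed.

Lemma axis_measurable : measurable axis.
Proof.
apply: measurableI; first exact: gasket_measurable.
apply: closed_plane_measurable.
rewrite (_ : [set _ | _] = fst @^-1` [set 2^-1 : R]) //.
by apply: closed_comp; [move=> x _; exact: cvg_fst|exact: closed_eq].
Qed.

Lemma axis_null (mu : {finite_measure set (plane R) -> \bar R}) :
  atomless mu -> mu axis = 0%E.
Proof.
move=> mu0; have set1_null p : K p -> mu.-negligible [set p].
  by move=> Kp; apply/negligibleP; [exact: plane_set1_measurable|exact: mu0].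
apply/negligibleP; first exact: axis_measurable.
apply: (@negligibleS _ _ _ mu ([set q R ord0] `|`
  \bigcup_n ([set Fw (chain n 1) (q R 2)] `|` [set Fw (chain n 2) (q R 1)]))).
  by move=> x /axisP[->|[n [->|->]]]; [left|right; exists n => //; left|
    right; exists n => //; right].
apply: negligibleU; first exact/set1_null/gasket_q.
apply: negligible_bigcup => n.
by apply: negligibleU; apply: set1_null; apply: (gasket_Fw attr); exact: gasket_q.
Qed.

(** At a point common to both halves the value is the sum of [uL] and [uR]. Hence the comparison on
    a cell of a chain leaves out its corner on the axis, which is a null set. *)
Definition glue (uL uR : plane R -> R) x : R :=
  \1_(half_gasket 1) x * uL x + \1_(half_gasket 2) x * uR x.

Section glue.
Variables (uL uR : plane R -> R).
Hypothesis uLD : half_dom 1 uL.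
Hypothesis uRD : half_dom 2 uR.

Lemma glue_left x : half_gasket 1 x -> ~ half_gasket 2 x -> glue uL uR x = uL x.
Proof. by move=> x1 x2; rewrite /glue !indicE (mem_set x1) (memNset x2) mul1r mul0r addr0. Qed.

Lemma glue_right x : ~ half_gasket 1 x -> half_gasket 2 x -> glue uL uR x = uR x.
Proof. by move=> x1 x2; rewrite /glue !indicE (memNset x1) (mem_set x2) mul1r mul0r add0r. Qed.

Lemma glue_chain1 n x : cell (chain n 1) x -> x <> Fw (chain n 1) (q R 2) ->
  glue uL uR x = uL x.
Proof.
move=> nx xp; apply: glue_left; first by apply/half_gasketE; exists n.
move=> /half_gasketE[m mx]; apply: xp; apply: (chain_axis attr _ _ _ nx) => //.
apply/eqP; rewrite eq_le (chain_side attr _ _ _ nx) //.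
exact: (chain_side attr _ _ _ mx).
Qed.

Lemma glue_chain2 n x : cell (chain n 2) x -> x <> Fw (chain n 2) (q R 1) ->
  glue uL uR x = uR x.
Proof.
move=> nx xp; apply: glue_right; last by apply/half_gasketE; exists n.
move=> /half_gasketE[m mx]; apply: xp; apply: (chain_axis attr _ _ _ nx) => //.
apply/eqP; rewrite eq_le (chain_side attr _ _ _ nx) //.
exact: (chain_side attr _ _ _ mx).
Qed.

Lemma glue_bounded : exists M, [/\ 0 <= M, forall x, `|glue uL uR x| <= M,
  forall x, half_gasket 1 x -> `|uL x| <= M & forall x, half_gasket 2 x -> `|uR x| <= M].
Proof.
have [M M0 MP] := half_bounded attr uLD; have [N N0 NP] := half_bounded attr uRD.
exists (M + N); split=> [|x|x /MP ?|x /NP ?]; [lra| |lra|lra].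
rewrite /glue !indicE; apply: le_trans (ler_normD _ _) _.
apply: lerD.
  by case: (boolP (x \in _)) => [/set_mem/MP|_]; rewrite ?mul1r ?mul0r ?normr0.
by case: (boolP (x \in _)) => [/set_mem/NP|_]; rewrite ?mul1r ?mul0r ?normr0.
Qed.

Lemma glue_measurable : measurable_fun setT (glue uL uR).
Proof.
have mi i u : {within half_gasket i, continuous u} ->
    measurable_fun setT (fun x => \1_(half_gasket i) x * u x).
  move=> cu; have mH := half_gasket_measurable i.
  rewrite (_ : (fun x => _) = u \_ (half_gasket i)).
    exact: ((measurable_restrictT u mH).1 (continuous_plane_measurable mH cu)).
  apply/funext => x; rewrite /patch indicE.
  by case: (boolP (x \in _)); rewrite ?mul1r ?mul0r.
by apply: measurable_funD; apply: mi; [case: uLD|case: uRD].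
Qed.

(** Within the distance |x_1 - 1/2| all points of the gasket lie strictly on the same side of the
    axis, where [glue] coincides with one of the two functions. *)
Lemma glue_continuous x : K x -> x.1 != 2^-1 -> forall e, 0 < e ->
  exists2 d, 0 < d & forall y, K y -> `|x - y| < d -> `|glue uL uR x - glue uL uR y| < e.
Proof.
move=> Kx x1 e e0.
have x0 : 0 < `|x.1 - 2^-1| by rewrite normr_gt0 subr_eq0.
have q1 : (q R ord0).1 = 2^-1 by [].
have side y : K y -> `|x - y| < `|x.1 - 2^-1| ->
    [/\ `|x.1 - y.1| < `|x.1 - 2^-1|, y.1 != 2^-1 & half_gasket 1 y \/ half_gasket 2 y].
  rewrite prod_normE gt_max => Ky /andP[/= xy _].
  have y1 : y.1 != 2^-1 by apply: contraTneq xy => ->; rewrite ltxx.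
  split=> //; case: (gasket_halves attr Ky) => [yq|?|?]; [|by left|by right].
  by move: y1; rewrite yq q1 eqxx.
case: (ltrgtP x.1 2^-1) x1 => // xh _.
- have left_ y : K y -> `|x - y| < `|x.1 - 2^-1| -> half_gasket 1 y /\ ~ half_gasket 2 y.
    move=> Ky /(side y Ky)[xy y1 hy].
    have yh : y.1 < 2^-1
      by move: xy; rewrite (ltr0_norm (x := _ - 2^-1)) ?subr_lt0 // ltr_norml; lra.
    have n2 : ~ half_gasket 2 y by move=> /(half2_ge attr); lra.
    by case: hy.
  have xx : `|x - x| < `|x.1 - 2^-1| by rewrite subrr normr0.
  have [x1 x2] := left_ x Kx xx.
  have [cL _ _] := uLD; have [d d0 dP] := (within_continuousP _ _).1 cL x x1 e e0.
  exists (Num.min d `|x.1 - 2^-1|); first by rewrite lt_min d0.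
  move=> y Ky; rewrite lt_min => /andP[xyd /(left_ y Ky)[y1 y2]].
  by rewrite !glue_left //; exact: dP.
- have right_ y : K y -> `|x - y| < `|x.1 - 2^-1| -> ~ half_gasket 1 y /\ half_gasket 2 y.
    move=> Ky /(side y Ky)[xy y1 hy].
    have yh : 2^-1 < y.1
      by move: xy; rewrite (gtr0_norm (x := _ - 2^-1)) ?subr_gt0 // ltr_norml; lra.
    have n1 : ~ half_gasket 1 y by move=> /(half1_le attr); lra.
    by case: hy.
  have xx : `|x - x| < `|x.1 - 2^-1| by rewrite subrr normr0.
  have [x1 x2] := right_ x Kx xx.
  have [cR _ _] := uRD; have [d d0 dP] := (within_continuousP _ _).1 cR x x2 e e0.
  exists (Num.min d `|x.1 - 2^-1|); first by rewrite lt_min d0.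
  move=> y Ky; rewrite lt_min => /andP[xyd /(right_ y Ky)[y1 y2]].
  by rewrite !glue_right //; exact: dP.
Qed.

Definition cutoff (k : nat) (x : plane R) : R := Num.min 1 (k%:R * `|x.1 - 2^-1|).

Lemma cutoff_ge0 k x : 0 <= cutoff k x.
Proof. by rewrite le_min ler01 mulr_ge0. Qed.

Lemma cutoff_le1 k x : cutoff k x <= 1.
Proof. by rewrite ge_min lexx. Qed.

Lemma cutoff_continuous k : continuous (cutoff k).
Proof.
move=> x; pose f (y : plane R) : R^o := 1; pose g (y : plane R) : R^o := k%:R * `|y.1 - 2^-1|.
have cf : {for x, continuous f} by exact: cvg_cst.
have cg : {for x, continuous g}.
  by apply: cvgMr; apply: cvg_norm; apply: cvgB; [exact: cvg_fst|exact: cvg_cst].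
exact: (continuous_min cf cg).
Qed.

(* The two halves meet only on the axis, where the cutoff vanishes; this makes
   the product continuous although u is not. *)
Definition glue_cut k x := glue uL uR x * cutoff k x.

Lemma glue_cut_le k x M : `|glue uL uR x| <= M -> `|glue_cut k x| <= M.
Proof.
move=> uM; rewrite normrM (ger0_norm (cutoff_ge0 _ _)).
by apply: le_trans uM; rewrite ler_piMr // cutoff_le1.
Qed.

Lemma glue_cut_CK k : CK (glue_cut k).
Proof.
have [M [M0 uM _ _]] := glue_bounded.
apply/subspace_continuousP => x Kx; have [x1|x1] := eqVneq x.1 2^-1; last first.
  apply: cvgM; last by apply: cvg_within_filter; exact: cutoff_continuous.
  apply/cvgrPdist_lt => e e0; have [d d0 dP] := glue_continuous Kx x1 e0.
  by rewrite near_withinE; apply/nbhs_distP; exists d => // y xy Ky; exact: dP.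
have c0 : cutoff k x = 0.
  by rewrite /cutoff x1 subrr normr0 mulr0; apply/min_idPr.
have MC : M * cutoff k y @[y --> x] --> M * 0.
  by rewrite -c0; apply: cvgMr; exact: cutoff_continuous.
have g0 : glue_cut k x = 0 by rewrite /glue_cut c0 mulr0.
rewrite [X in _ --> X]g0; apply/cvgrPdist_le => e e0.
rewrite mulr0 in MC; move/cvgrPdist_le : MC => /(_ e e0).
rewrite near_withinE; apply: filterS => y; rewrite !sub0r !normrN => My _.
apply: le_trans My; rewrite !normrM; apply: ler_wpM2r => //.
by rewrite (ger0_norm M0).
Qed.

Lemma glue_cut_cvg x : K x -> ~ axis x -> glue_cut k x @[k --> \oo] --> glue uL uR x.
Proof.
move=> Kx nx; have x0 : 0 < `|x.1 - 2^-1|.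
  by rewrite normr_gt0 subr_eq0; apply/eqP => x1; apply: nx.
(* As soon as k exceeds 1/|x_1 - 1/2| the cutoff is 1 at x, so the sequence is eventually
   constant. *)
pose N := Num.Def.truncn (`|x.1 - 2^-1|^-1); apply: cvg_near_cst.
exists N.+1 => // k /= Nk; rewrite /glue_cut /cutoff (min_idPl _) ?mulr1 //.
rewrite -ler_pdivrMr // mul1r (le_trans (ltW (truncnS_gt _))) // ler_nat //.
Qed.

End glue.
End gluing.

(** * The bound on the divergence functional *)

Section divergence_bound.
Variable R : realType.
Hypothesis attr : is_attractor (@gasket R).
Local Notation K := (@gasket R).
Variables (h phi : plane R -> R) (nuhp nuhh : {charge set (plane R) -> \bar R}).
Variable nuh : {finite_measure set (plane R) -> \bar R}.
Hypothesis hh : is_harmonic h.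
Hypotheses (h0 : h (q R ord0) = 1) (h1 : h (q R 1) = 0) (h2 : h (q R 2) = 0).
Hypothesis phiF : domF0 phi.
Hypothesis nuhpE : forall w, nuhp (cell w) = (cell_energy w h phi)%:E.
Hypothesis nuhhE : forall w, nuhh (cell w) = (cell_energy w h h)%:E.
Hypothesis nuhE : forall A, measurable A -> nuh A = nuhh A.
Variables (uL uR : plane R -> R).
Hypothesis uLD : half_dom 1 uL.
Hypothesis uRD : half_dom 2 uR.

Let hv := harmonic_vharmonic attr hh.
Let hF := hh.1.
Let phiC : CK phi. Proof. by case: phiF => -[]. Qed.
Let hp_small := energy_charge_small attr hv phiF.1 nuhpE.
Let hh_small := energy_charge_small attr hv hF nuhhE.

Lemma half_cell_continuous i n u : half_dom i u ->
  {within cell (chain n i), continuous (u : plane R -> R)}.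
Proof.
move=> [cu _ _]; apply: continuous_subspaceW cu => x nx.
by apply/half_gasketE; exists n.
Qed.

(** By [chain_boundary] the boundary term of the cell is the difference of u phi at two successive
    junctions, which is what makes the sum over the chain telescope. *)
Lemma chain_integral_bound i n u : i != ord0 -> half_dom i u ->
  2 * `|charge_integral nuhp (cell (chain n i)) u -
        (u (junction R i n.+1) * phi (junction R i n.+1) -
         u (junction R i n) * phi (junction R i n))| <=
  charge_integral nuhh (cell (chain n i)) (fun x => phi x * phi x) +
  cell_energy (chain n i) u u.
Proof.
move=> i0 uD; have cu := half_cell_continuous (n := n) uD.
have := cell_integral_bound attr hv hF phiF.1 nuhpE nuhhE cu (chain_domF uD n).
by rewrite (chain_boundary n _ i0 hv h0 h1 h2) /vals Fw_chain_q Fw_chain_q0.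
Qed.

Let phi2C : CK (fun x => phi x * phi x). Proof. exact: CK_M. Qed.

Lemma phi2_integral w : charge_integral nuhh (cell w) (fun x => phi x * phi x) =
  \int[nuh]_(x in cell w) (phi x * phi x).
Proof.
have cw := CK_cell attr (w := w) phi2C.
have [M phiM] := continuous_cell_bounded attr cw.
have mw := cell_measurable attr w.
exact: (charge_integral_measure nuhE mw (continuous_plane_measurable mw cw) phiM).
Qed.

Lemma sum_phi2_integral N :
  \sum_(n < N) (charge_integral nuhh (cell (chain n 1)) (fun x => phi x * phi x) +
                charge_integral nuhh (cell (chain n 2)) (fun x => phi x * phi x)) <=
  \int[nuh]_(x in K) (phi x * phi x).
Proof.
pose J w := charge_integral nuhh (cell w) (fun x => phi x * phi x).
have JE w : J w = \sum_(i < 3) J (rcons w i).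
  have cw := CK_cell attr (w := w) phi2C.
  have [M phiM] := continuous_cell_bounded attr cw.
  have mw := cell_measurable attr w.
  exact: (charge_integral_cell_rcons attr hh_small
    (continuous_plane_measurable mw cw) phiM).
have := chain_decomposition N JE; rewrite /J phi2_integral cell_nil => ->.
rewrite lerDr phi2_integral; apply: Rintegral_ge0 => x _.
by rewrite -expr2 sqr_ge0.
Qed.

(** [J] will be the integral of the glued function. Stating the bound for [J] separates the
    telescoping from the exchange of [glue] for [uL] and [uR] on the cells. *)
Lemma chain_sum_bound N (J : seq 'I_3 -> R) :
  (forall n, J (chain n 1) = charge_integral nuhp (cell (chain n 1)) uL) ->
  (forall n, J (chain n 2) = charge_integral nuhp (cell (chain n 2)) uR) ->
  2 * `|\sum_(n < N) (J (chain n 1) + J (chain n 2)) -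
    (uL (junction R 1 N) * phi (junction R 1 N) + uR (junction R 2 N) * phi (junction R 2 N))| <=
  \int[nuh]_(x in K) (phi x * phi x) + (half_energy 1 uL + half_energy 2 uR).
Proof.
move=> J1 J2.
pose b1 n := uL (junction R 1 n) * phi (junction R 1 n).
pose b2 n := uR (junction R 2 n) * phi (junction R 2 n).
(* The telescoping sums start at q_1 and q_2, where [phi] vanishes. *)
have b10 : b1 0%N = 0.
  by rewrite /b1 /junction /= (phiF.2 (q R 1)) ?mulr0 //; exists 1.
have b20 : b2 0%N = 0.
  by rewrite /b2 /junction /= (phiF.2 (q R 2)) ?mulr0 //; exists 2.
have -> : \sum_(n < N) (J (chain n 1) + J (chain n 2)) - (b1 N + b2 N) =
    \sum_(n < N) ((J (chain n 1) - (b1 n.+1 - b1 n)) + (J (chain n 2) - (b2 n.+1 - b2 n))).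
  elim: N => [|N IH]; first by rewrite !big_ord0 b10 b20 addr0 subrr.
  by rewrite [RHS]big_ord_recr /= -IH big_ord_recr /=; ring.
apply: (@le_trans _ _ (\sum_(n < N)
  ((charge_integral nuhh (cell (chain n 1)) (fun x => phi x * phi x) +
    charge_integral nuhh (cell (chain n 2)) (fun x => phi x * phi x)) +
   (cell_energy (chain n 1) uL uL + cell_energy (chain n 2) uR uR)))).
  apply: le_trans (ler_wpM2l _ (ler_norm_sum _ _ _)) _ => //.
  rewrite mulr_sumr; apply: ler_sum => n _.
  have := @chain_integral_bound 1 n uL isT uLD.
  have := @chain_integral_bound 2 n uR isT uRD.
  rewrite -J1 -J2 -/(b1 _) -/(b1 _) -/(b2 _) -/(b2 _) => H2 H1.
  apply: le_trans (ler_wpM2l _ (ler_normD _ _)) _ => //; lra.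
rewrite big_split; apply: lerD; first exact: sum_phi2_integral.
by rewrite big_split; apply: lerD; apply: sum_chain_energy.
Qed.

(** The limit of [chain_sum_bound] as N grows: the integral over F_0^N(K) disappears since q_0 has
    no mass, and the boundary term at the N-th junctions since [phi] tends to phi(q_0) = 0 there. *)
Lemma divergence_bound :
  2 * `|charge_integral nuhp K (glue uL uR)| <=
  \int[nuh]_(x in K) (phi x * phi x) + (half_energy 1 uL + half_energy 2 uR).
Proof.
have [M [M0 uM uLM uRM]] := glue_bounded attr uLD uRD.
have mu := glue_measurable attr uLD uRD.
have muD D : measurable_fun D (glue uL uR) by exact: measurable_funS mu.
pose J w := charge_integral nuhp (cell w) (glue uL uR).
have JE w : J w = \sum_(i < 3) J (rcons w i).
  by apply: (charge_integral_cell_rcons attr hp_small (M := M)).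
have J1 n : J (chain n 1) = charge_integral nuhp (cell (chain n 1)) uL.
  have mw := cell_measurable attr (chain n 1).
  apply: (charge_integral_eq_set1 attr hp_small (p := Fw (chain n 1) (q R 2)) (M := M)) => //.
  - exact/(gasket_Fw attr)/gasket_q.
  - exact: continuous_plane_measurable (half_cell_continuous (n := n) uLD).
  - by move=> x nx; apply: uLM; apply/half_gasketE; exists n.
  - by move=> x nx; exact: glue_chain1.
have J2 n : J (chain n 2) = charge_integral nuhp (cell (chain n 2)) uR.
  have mw := cell_measurable attr (chain n 2).
  apply: (charge_integral_eq_set1 attr hp_small (p := Fw (chain n 2) (q R 1)) (M := M)) => //.
  - exact/(gasket_Fw attr)/gasket_q.
  - exact: continuous_plane_measurable (half_cell_continuous (n := n) uRD).
  - by move=> x nx; apply: uRM; apply/half_gasketE; exists n.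
  - by move=> x nx; exact: glue_chain2.
pose b N := uL (junction R 1 N) * phi (junction R 1 N) + uR (junction R 2 N) * phi (junction R 2 N).
have tail : J (nseq N ord0) @[N --> \oo] --> 0.
  exact: (charge_integral_tail_cvg attr hp_small M0 (muD K) (fun x _ => uM x)).
have prod0 i u : half_dom i u -> (forall x, half_gasket i x -> `|u x| <= M) -> i != ord0 ->
    u (junction R i N) * phi (junction R i N) @[N --> \oo] --> 0.
  move=> uD uiM i0; have := junction_cvg attr i phiC.
  rewrite (phiF.2 (q R ord0)); last by exists ord0.
  move=> p0; have : M * phi (junction R i N) @[N --> \oo] --> M * 0 by apply: cvgMr.
  rewrite mulr0 => /cvgrPdist_le Mp; apply/cvgrPdist_le => e e0.
  have := Mp e e0; apply: filterS => N; rewrite !sub0r !normrN; apply: le_trans.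
  rewrite !normrM; apply: ler_wpM2r => //; rewrite (ger0_norm M0); apply: uiM.
  by apply/half_gasketE; exists N; rewrite -Fw_chain_q; exact: cell_q.
have b0 : b N @[N --> \oo] --> 0.
  rewrite -[X in _ --> X](addr0 0).
  by apply: cvgD; [exact: (prod0 1)|exact: (prod0 2)].
have lim : 2 * `|J [::] - J (nseq N ord0) - b N| @[N --> \oo] --> 2 * `|J [::] - 0 - 0|.
  apply: cvgMr; apply: cvg_norm; apply: cvgB; last exact: b0.
  by apply: cvgB; [exact: cvg_cst|exact: tail].
rewrite !subr0 /J cell_nil in lim.
apply: (ler_cvg_to lim (cvg_cst _)); apply: nearW => N.
rewrite -[charge_integral _ K _]/(charge_integral _ K (glue uL uR)).
have := chain_sum_bound N J1 J2.
by have := chain_decomposition N JE; rewrite /J cell_nil => ->; rewrite [X in X - _ - _]addrC addrK.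
Qed.

End divergence_bound.

(** * Representation of bounded functionals *)

Section representation.
Context d (T : measurableType d) (R : realType).
Variable mu : {finite_measure set T -> \bar R}.
Variable D : set T.
Hypothesis mD : measurable D.
Implicit Types (f g psi : T -> R).

Definition bounded_on f := measurable_fun D f /\ exists M, forall x, D x -> `|f x| <= M.

Lemma bounded_on_integrable f : bounded_on f -> mu.-integrable D (EFin \o f).
Proof. by move=> [mf [M fM]]; exact: bounded_integrable fM. Qed.

Lemma bounded_on_M f g : bounded_on f -> bounded_on g -> bounded_on (fun x => f x * g x).
Proof.
move=> [mf [M fM]] [mg [N gN]]; split; first exact: measurable_funM.
by exists (M * N) => x Dx; rewrite normrM ler_pM ?fM ?gN.
Qed.

Lemma bounded_on_lin r s f g : bounded_on f -> bounded_on g ->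
  bounded_on (fun x => r * f x + s * g x).
Proof.
move=> [mf [M fM]] [mg [N gN]]; split.
  by apply: measurable_funD; apply: measurable_funM => //; exact: measurable_cst.
exists (`|r| * M + `|s| * N) => x Dx; apply: le_trans (ler_normD _ _) _.
by rewrite !normrM lerD // ler_wpM2l // ?fM ?gN.
Qed.

Lemma bounded_on_norm f : bounded_on f -> bounded_on (fun x => `|f x|).
Proof.
move=> [mf [M fM]]; split; first exact: measurableT_comp.
by exists M => x Dx; rewrite normr_id fM.
Qed.

Lemma bounded_on_cst r : bounded_on (cst r).
Proof. by split; [exact: measurable_cst|exists `|r|]. Qed.

Definition ip f g : R := \int[mu]_(x in D) (f x * g x).

Lemma ipC f g : ip f g = ip g f.
Proof. by apply: eq_Rintegral => x _; rewrite mulrC. Qed.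

Lemma ip_linl r s f g psi : bounded_on f -> bounded_on g -> bounded_on psi ->
  ip (fun x => r * f x + s * g x) psi = r * ip f psi + s * ip g psi.
Proof.
move=> fb gb pb; have fp := bounded_on_integrable (bounded_on_M fb pb).
have gp := bounded_on_integrable (bounded_on_M gb pb).
rewrite /ip -!RintegralZl // -RintegralD //.
- by apply: eq_Rintegral => x _; ring.
- exact/bounded_on_integrable/bounded_on_M/bounded_on_M/pb/fb/bounded_on_cst.
- exact/bounded_on_integrable/bounded_on_M/bounded_on_M/pb/gb/bounded_on_cst.
Qed.

Lemma ip_linr r s f g psi : bounded_on f -> bounded_on g -> bounded_on psi ->
  ip psi (fun x => r * f x + s * g x) = r * ip psi f + s * ip psi g.
Proof. by move=> *; rewrite ipC ip_linl // !(ipC psi). Qed.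

Lemma ip_ge0 f : 0 <= ip f f.
Proof. by apply: Rintegral_ge0 => x _; rewrite -expr2 sqr_ge0. Qed.

Lemma normed_summable_cvg (phi : nat -> R) (S : \bar R) : (S < +oo)%E ->
  (forall n, ((\sum_(k < n) `|phi k.+1 - phi k|)%:E <= S)%E) ->
  cvg (phi n @[n --> \oo]).
Proof.
move=> Soo phiS.
have : cvgn [normed series (fun k => phi k.+1 - phi k)].
  apply: nondecreasing_is_cvgn.
    by apply/nondecreasing_seqP => n; rewrite /= !seriesEnat /= big_nat_recr //= lerDl.
  have S0 : (0 <= S)%E by have := phiS 0%N; rewrite big_ord0.
  exists (fine S) => _ [n _ <-]; rewrite /= seriesEnat /= big_mkord.
  by rewrite -lee_fin fineK // ge0_fin_numE.
move=> /normed_cvg; rewrite seriesEnat => /cvg_ex[l Hl]; apply/cvg_ex.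
exists (l + phi 0%N); have : series (fun k => phi k.+1 - phi k) n + phi 0%N
  @[n --> \oo] --> l + phi 0%N.
  by apply: cvgD; [exact: Hl|exact: cvg_cst].
apply: cvg_trans; apply: near_eq_cvg; apply: nearW => n.
by rewrite /series /= telescope_sumr // subrK.
Qed.

(** The argument of Riesz-Fischer: the sum of all increments is integrable, hence finite off a null
    set. There the sequence converges, and |phi_0| plus this sum dominates it. *)
Lemma summable_increments (phi : nat -> T -> R) c :
  (forall n, bounded_on (phi n)) ->
  (forall n, \int[mu]_(x in D) `|phi n.+1 x - phi n x| <= c * 2^-1 ^+ n) ->
  exists A g Phi, [/\ [/\ measurable A, A `<=` D & mu (D `\` A) = 0%E],
    measurable_fun setT g /\ (forall x, ~ A x -> g x = 0),
    (forall x, A x -> phi n x @[n --> \oo] --> g x),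
    mu.-integrable A Phi &
    (forall n x, A x -> (`|phi n x|%:E <= Phi x)%E)].
Proof.
move=> phib phic; pose dl n x : R := `|phi n.+1 x - phi n x|.
have dlb n : bounded_on (dl n).
  apply: bounded_on_norm; have := bounded_on_lin 1 (-1) (phib n.+1) (phib n).
  by congr bounded_on; apply/funext => x; rewrite mul1r mulN1r.
pose S x : \bar R := (\sum_(n <oo) (dl n x)%:E)%E.
have mdl n : measurable_fun D (fun x => (dl n x)%:E).
  by apply/measurable_EFinP; case: (dlb n).
have dl0 n x : D x -> (0 <= (dl n x)%:E)%E by move=> _; rewrite lee_fin normr_ge0.
have S_ge0 x : (0 <= S x)%E by apply: nneseries_ge0 => n _ _; rewrite lee_fin normr_ge0.
have mS : measurable_fun D S.
  have := @ge0_emeasurable_sum _ _ _ D (fun k x => (dl k x)%:E) xpredT.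
  apply; first by move=> k x Dx _; exact: dl0.
  by move=> k _; exact: mdl.
have intS : (\int[mu]_(x in D) S x <= (2 * c)%:E)%E.
  rewrite integral_nneseries //; apply: lime_le.
    by apply: is_cvg_nneseries => n _ _; apply: integral_ge0 => x Dx; exact: dl0.
  apply: nearW => N; rewrite big_mkord.
  have dlE n : (\int[mu]_(x in D) (dl n x)%:E = (\int[mu]_(x in D) dl n x)%:E)%E.
    by rewrite fineK //; apply: (integrable_fin_num mD); exact: bounded_on_integrable.
  rewrite (eq_bigr _ (fun (n : 'I_N) _ => dlE n)) sumEFin lee_fin.
  have c0 : 0 <= c.
    by have := phic 0%N; rewrite expr0 mulr1; apply: le_trans; exact: Rintegral_ge0.
  (* The first summand is the exact value of the partial geometric sum, which the induction
     needs. *)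
  have -> : 2 * c = c * (2 - 2 * 2^-1 ^+ N) + c * (2 * 2^-1 ^+ N) by ring.
  apply: ler_wpDr; first by rewrite !mulr_ge0 // exprn_ge0 // invr_ge0.
  elim: N => [|N IH]; first by rewrite big_ord0 expr0 mulr1 subrr mulr0.
  rewrite big_ord_recr /=; apply: le_trans (lerD IH (phic N)) _.
  by rewrite exprS le_eqVlt; apply/orP; left; apply/eqP; field.
have Si : mu.-integrable D S.
  apply/integrableP; split => //; apply: le_lt_trans (ltry (2 * c)).
  by rewrite (eq_integral S) // => x _; rewrite gee0_abs.
have [N0 [mN0 N00 SN]] := integrable_ae mD Si.
pose A := D `\` N0; have mA : measurable A by exact: measurableD.
have AD : A `<=` D by move=> x [].
have Soo x : A x -> (S x < +oo)%E.
  move=> [Dx nNx]; rewrite -ge0_fin_numE //; apply: contrapT => Sx; apply: nNx.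
  by apply: SN => /= /(_ Dx).
have sumS n x : ((\sum_(k < n) dl k x)%:E <= S x)%E.
  rewrite -sumEFin -(big_mkord xpredT (fun k => (dl k x)%:E)).
  by apply: nneseries_lim_ge => k _ _; rewrite lee_fin normr_ge0.
have cvgphi x : A x -> cvg (phi n x @[n --> \oo]).
  by move=> Ax; apply: (@normed_summable_cvg (phi ^~ x) _ (Soo x Ax)) => n; exact: sumS.
pose g0 x := lim (phi n x @[n --> \oo]).
exists A, (g0 \_ A), (fun x => (`|phi 0%N x|%:E + S x)%E); split.
- split=> //; rewrite /A setDD; apply/eqP; rewrite eq_le measure_ge0 andbT -N00.
  by apply: le_measure; rewrite ?inE //; exact: measurableI.
- split=> [|x nAx]; last by rewrite /patch memNset.
  have mg0 : measurable_fun A g0.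
    apply: (measurable_fun_cvg (h := phi)); last by move=> x /cvgphi.
    by move=> n; case: (phib n) => mp _; exact: measurable_funS mp.
  exact: (measurable_restrictT g0 mA).1 mg0.
- by move=> x Ax; rewrite /patch mem_set //; exact: cvgphi.
- apply: integrableD => //; last exact: integrableS Si.
  apply: (@integrableS _ _ _ mu D) => //.
  exact: (bounded_on_integrable (bounded_on_norm (phib 0%N))).
- move=> n x Ax; apply: le_trans (leeD2l _ (sumS n x)); rewrite -EFinD lee_fin.
  have : phi n x = phi 0%N x + \sum_(k < n) (phi k.+1 x - phi k x).
    by rewrite -(big_mkord xpredT (fun k => phi k.+1 x - phi k x)) telescope_sumr // addrC subrK.
  move=> ->; apply: le_trans (ler_normD _ _) _; rewrite lerD2l.
  exact: ler_norm_sum.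
Qed.

Lemma Rintegral_full A f : measurable A -> A `<=` D -> mu (D `\` A) = 0%E ->
  bounded_on f -> \int[mu]_(x in D) f x = \int[mu]_(x in A) f x.
Proof.
move=> mA AD DA0 fb; rewrite /Rintegral; congr fine.
rewrite (negligible_integral (measurableD mD mA) mD (bounded_on_integrable fb) DA0).
by rewrite setDD setIidr.
Qed.

Lemma weak_limit A (phi : nat -> T -> R) g Phi psi :
  measurable A -> A `<=` D -> mu (D `\` A) = 0%E ->
  (forall n, bounded_on (phi n)) -> bounded_on psi ->
  measurable_fun setT g -> (forall x, ~ A x -> g x = 0) ->
  (forall x, A x -> phi n x @[n --> \oo] --> g x) ->
  mu.-integrable A Phi -> (forall n x, A x -> (`|phi n x|%:E <= Phi x)%E) ->
  ip (phi n) psi @[n --> \oo] --> \int[mu]_(x in D) (g x * psi x).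
Proof.
move=> mA AD DA0 phib psib mg g0 phig Phii phiPhi.
have -> : \int[mu]_(x in D) (g x * psi x) = \int[mu]_(x in A) (g x * psi x).
  rewrite Rintegral_mkcond [RHS]Rintegral_mkcond; apply: eq_Rintegral => x _.
  rewrite /patch; case: (boolP (x \in A)) => [/set_mem xA|/negP xA].
    by rewrite mem_set //; exact: AD.
  by rewrite g0 ?mul0r ?if_same // => xA'; apply: xA; exact: mem_set.
under eq_fun do rewrite /ip (Rintegral_full mA AD DA0 (bounded_on_M (phib _) psib)).
have [mpsi [M psiM]] := psib.
have mpsiA : measurable_fun A psi by exact: measurable_funS mpsi.
have mphiA n : measurable_fun A (phi n).
  by have [mp _] := phib n; exact: measurable_funS mp.
have [||||| fi _] := @dominated_convergence _ _ _ mu A mA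
  (fun n x => (phi n x * psi x)%:E) (fun x => (g x * psi x)%:E)
  (fun x => (`|M|%:E * Phi x)%E).
- by move=> n; apply/measurable_EFinP; exact: measurable_funM.
- by apply/measurable_EFinP; apply: measurable_funM => //; exact: measurable_funS mg.
- apply: aeW => x Ax; apply: cvg_EFin; first exact: nearW.
  by apply: cvgMl; exact: phig.
- exact: integrableZl.
- apply: aeW => x n Ax; rewrite abse_EFin normrM mulrC EFinM.
  apply: lee_pmul => //; rewrite ?lee_fin ?normr_ge0 //.
    by apply: le_trans (ler_norm _); apply: psiM; exact: AD.
  exact: phiPhi.
by rewrite -(fineK (integrable_fin_num mA fi)); exact: fine_cvg.
Qed.

(** The dominating function of the previous lemmas is merely integrable, so square integrability of
    the limit comes from Fatou's lemma. *)
Lemma Fatou_sqr A (phi : nat -> T -> R) g B :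
  measurable A -> A `<=` D -> mu (D `\` A) = 0%E ->
  (forall n, bounded_on (phi n)) -> (forall x, ~ A x -> g x = 0) ->
  (forall x, A x -> phi n x @[n --> \oo] --> g x) ->
  (forall n, ip (phi n) (phi n) <= B) ->
  (\int[mu]_(x in D) (g x ^+ 2)%:E <= B%:E)%E.
Proof.
move=> mA AD DA0 phib g0 phig phiB.
have -> : (\int[mu]_(x in D) (g x ^+ 2)%:E = \int[mu]_(x in A) (g x ^+ 2)%:E)%E.
  rewrite integral_mkcond [RHS]integral_mkcond; apply: eq_integral => x _.
  rewrite /patch; case: (boolP (x \in A)) => [/set_mem xA|/negP xA].
    by rewrite mem_set //; exact: AD.
  by rewrite g0 ?expr0n ?if_same // => xA'; apply: xA; exact: mem_set.
have mphiA n : measurable_fun A (phi n).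
  by have [mp _] := phib n; exact: measurable_funS mp.
have := @fatou _ _ _ mu A mA (fun n x => (phi n x * phi n x)%:E).
have -> : (\int[mu]_(x in A) limn_einf (fun n => (phi n x * phi n x)%:E) =
    \int[mu]_(x in A) (g x ^+ 2)%:E)%E.
  apply: eq_integral => x /set_mem Ax.
  have gx : (phi n x * phi n x)%:E @[n --> \oo] --> (g x ^+ 2)%:E.
    by apply: cvg_EFin; [exact: nearW|apply: cvgM; exact: phig].
  by rewrite is_cvg_limn_einfE; [exact/cvg_lim|apply/cvg_ex; eexists; exact: gx].
move=> /(_ _ _)/le_trans; apply.
- by move=> n; apply/measurable_EFinP; exact: measurable_funM.
- by move=> n x _; rewrite lee_fin -expr2 sqr_ge0.
have phiA n : (\int[mu]_(x in A) (phi n x * phi n x)%:E <= B%:E)%E.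
  have fi := bounded_on_integrable (bounded_on_M (phib n) (phib n)).
  have fiA := integrableS mD mA AD fi.
  rewrite -(fineK (integrable_fin_num mA fiA)) lee_fin.
  by apply: le_trans (phiB n);
    rewrite /ip (Rintegral_full mA AD DA0 (bounded_on_M (phib n) (phib n))).
rewrite limn_einf_lim; apply: lime_le; first exact: is_cvg_einfs.
apply: nearW => n; apply: le_trans (phiA n).
by apply: ereal_inf_lbound; exists n => /=.
Qed.

(* g is the limit of a minimising sequence of ip f f - 2 ell f; the bound on ell
   says that this functional is bounded below. *)
Lemma representation (S : set (T -> R)) (ell : (T -> R) -> R) C :
  S !=set0 -> (forall f, S f -> bounded_on f) ->
  (forall r s f g, S f -> S g -> S (fun x => r * f x + s * g x)) ->
  (forall r s f g, S f -> S g ->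
    ell (fun x => r * f x + s * g x) = r * ell f + s * ell g) ->
  (forall f, S f -> 2 * `|ell f| <= ip f f + C) ->
  exists g, [/\ measurable_fun setT g, forall x, ~ D x -> g x = 0,
    (\int[mu]_(x in D) (g x ^+ 2)%:E < +oo)%E &
    forall f, S f -> ell f = \int[mu]_(x in D) (g x * f x)].
Proof.
move=> [f0 Sf0] Sb Slin elin ellC.
pose Q f := ip f f - 2 * ell f.
have Q_ge f : S f -> - C <= Q f.
  by move=> Sf; have := ellC f Sf; have := ler_norm (ell f); rewrite /Q; lra.
pose I := inf (Q @` S).
have hI : has_inf (Q @` S).
  by split; [exists (Q f0), f0|exists (- C) => _ [f Sf <-]; exact: Q_ge].
have I_le f : S f -> I <= Q f.
  by move=> Sf; apply: ge_inf; [case: hI|exists f].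
have QE r s f g : S f -> S g -> Q (fun x => r * f x + s * g x) =
    r ^+ 2 * ip f f + 2 * r * s * ip f g + s ^+ 2 * ip g g - 2 * (r * ell f + s * ell g).
  move=> Sf Sg; have fb := Sb f Sf; have gb := Sb g Sg.
  rewrite /Q elin // ip_linl ?ip_linr //; last exact: bounded_on_lin.
  by rewrite (ipC g f); ring.
(* An excess of 4^-n leads to distances of order 2^-n in L^2, hence to summable increments in
   L^1. *)
have /choice[phi phiP] : forall n, exists f, S f /\ Q f <= I + 4^-1 ^+ n.
  move=> n.
  have e0 : 0 < (4^-1 : R) ^+ n by rewrite exprn_gt0 // invr_gt0.
  by have [_ [f Sf <-] fI] := inf_adherent e0 hI; exists f; split=> //; exact: ltW.
have phiS n : S (phi n) by case: (phiP n).
have phiQ n : Q (phi n) <= I + 4^-1 ^+ n by case: (phiP n).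
have phib n : bounded_on (phi n) by exact: Sb.
have e_le1 n : (4^-1 : R) ^+ n <= 1.
  by apply: exprn_ile1; rewrite ?invr_ge0 // invf_le1 // ler1n.
have phi_ip n : ip (phi n) (phi n) <= 2 * (I + 1 + 2 * C).
  (* The bound for f/2 gives 2 ell(f) <= ip f f / 2 + 2C, so [Q] controls half of the squared
     norm. *)
  have := ellC _ (Slin (1 / 2) 0 _ _ (phiS n) (phiS n)).
  rewrite elin // ip_linl ?ip_linr //; [|exact: bounded_on_lin].
  have := ler_norm (1 / 2 * ell (phi n) + 0 * ell (phi n)).
  by have := phiQ n; have := e_le1 n; rewrite /Q; lra.
have increments n : \int[mu]_(x in D) `|phi n.+1 x - phi n x| <=
    ((4 + mass mu D) / 2) * 2^-1 ^+ n.
  pose del x := 1 * phi n.+1 x + -1 * phi n x.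
  have delb : bounded_on del by exact: bounded_on_lin.
  (* The midpoint of two near-minimisers has [Q] at least [I]; the parallelogram law then bounds
     their distance by the excesses. *)
  have ip_del : ip del del <= 4 * 4^-1 ^+ n.
    have := I_le _ (Slin (1 / 2) (1 / 2) _ _ (phiS n.+1) (phiS n)).
    rewrite QE // /del ip_linl ?ip_linr // (ipC (phi n) (phi n.+1)).
    have : (4^-1 : R) ^+ n.+1 = 4^-1 * 4^-1 ^+ n by rewrite exprS.
    have : 0 <= (4^-1 : R) ^+ n by rewrite exprn_ge0 // invr_ge0.
    by have := phiQ n; have := phiQ n.+1; rewrite /Q; lra.
  have s0 : 0 < (2 : R) ^+ n by rewrite exprn_gt0.
  have sV : (2^-1 : R) ^+ n = (2 ^+ n)^-1 by rewrite exprVn.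
  (* The pointwise bound |d| <= (2^n d^2 + 2^-n)/2 replaces Cauchy-Schwarz in the passage from L^2
     to L^1. *)
  apply: (@le_trans _ _ (\int[mu]_(x in D)
      (2 ^+ n / 2 * (del x * del x) + 2^-1 ^+ n / 2 * cst 1 x))).
    apply: le_Rintegral => //.
    - apply: (bounded_on_integrable (bounded_on_norm _)).
      by have := delb; congr bounded_on; apply/funext => x; rewrite /del mul1r mulN1r.
    - apply: bounded_on_integrable; apply: bounded_on_lin; first exact: bounded_on_M.
      exact: bounded_on_cst.
    move=> x _; rewrite -(mul1r (phi n.+1 x)) -(mulN1r (phi n x)) -/(del x) sV /=.
    have := sqr_ge0 (2 ^+ n * `|del x| - 1); move: s0.
    have <- : `|del x| * `|del x| = del x * del x by rewrite -!expr2 real_normK ?num_real.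
    move: (_ ^+ n) `|del x| => s t s0 st.
    rewrite -subr_ge0 (_ : _ - _ = (s * t - 1) ^+ 2 / (2 * s)); last by field; rewrite gt_eqF.
    by rewrite divr_ge0 // mulr_ge0 // ltW.
  rewrite RintegralD //; first last.
  - apply: bounded_on_integrable; apply: bounded_on_M; exact: bounded_on_cst.
  - apply: bounded_on_integrable; apply: bounded_on_M; [exact: bounded_on_cst|exact: bounded_on_M].
  rewrite !RintegralZl //; first last.
  - by apply: bounded_on_integrable; exact: bounded_on_M.
  - by apply: bounded_on_integrable; exact: bounded_on_cst.
  rewrite -/(ip del del) Rintegral_cst // mul1r -/(mass mu D).
  apply: le_trans (lerD (ler_wpM2l _ ip_del) (lexx _)) _; first by rewrite divr_ge0 // ltW.
  have -> : (4^-1 : R) ^+ n = (2 ^+ n)^-1 * (2 ^+ n)^-1.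
    by rewrite -invfM -exprMn -exprVn; congr ((_^-1) ^+ _); ring.
  rewrite sV le_eqVlt; apply/orP; left; apply/eqP; field; by rewrite gt_eqF.
have [A [g [Phi [[mA AD DA0] [mg g0] phig Phii phiPhi]]]] := summable_increments phib increments.
exists g; split => //.
- by move=> x nDx; apply: g0 => /AD.
- by apply: le_lt_trans (Fatou_sqr mA AD DA0 phib g0 phig phi_ip) _; exact: ltry.
move=> psi Spsi; have psib := Sb _ Spsi.
have wl := weak_limit mA AD DA0 phib psib mg g0 phig Phii phiPhi.
set J := Rintegral _ _ _ in wl *.
(* First variation: Q(phi_n + t psi) >= I >= Q(phi_n) - 4^-n, expanded and passed to the limit. *)
have key t : 0 <= 2 * t * (J - ell psi) + t ^+ 2 * ip psi psi.
  have lim : 2 * t * (ip (phi n) psi - ell psi) + t ^+ 2 * ip psi psi + 4^-1 ^+ n @[n --> \oo]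
      --> 2 * t * (J - ell psi) + t ^+ 2 * ip psi psi + 0.
    apply: cvgD; last by apply: cvg_expr; rewrite ger0_norm ?invr_ge0 // invf_lt1 // ltr1n.
    by apply: cvgD; [apply: cvgMr; apply: cvgB; [exact: wl|exact: cvg_cst]|exact: cvg_cst].
  rewrite -[leRHS]addr0; apply: (ler_cvg_to (cvg_cst 0) lim); apply: nearW => n.
  have := I_le _ (Slin 1 t _ _ (phiS n) Spsi); rewrite QE //.
  by have := phiQ n; rewrite /Q; lra.
have P0 := ip_ge0 psi; move: (ip psi psi) P0 key => P P0 key.
apply/eqP; rewrite -subr_eq0 -sqrf_eq0 -opprB sqrrN eq_le sqr_ge0 andbT.
set c := J - ell psi in key *; have P1 : 0 < P + 1 by lra.
(* Nearly the minimising t, with P + 1 instead of P to allow P = 0. It yields a nonpositive multiple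
   of c^2, so c = 0. *)
have := key (- c / (P + 1)).
rewrite (_ : _ + _ = - (c ^+ 2) * ((P + 2) / (P + 1) ^+ 2)); last by field; rewrite gt_eqF.
rewrite mulNr oppr_ge0 pmulr_lle0 // divr_gt0 ?exprn_gt0 //; lra.
Qed.

End representation.

(** * The divergence of the glued function *)

Lemma Lfun2P d (T : measurableType d) (R : realType)
    (mu : {measure set T -> \bar R}) (f : T -> R) :
  measurable_fun setT f -> (\int[mu]_x (f x ^+ 2)%:E < +oo)%E ->
  f \in Lfun mu 2%:E.
Proof.
move=> mf f2; rewrite inE; apply/andP; split; rewrite inE //=.
rewrite /finite_norm unlock; apply: poweR_lty; apply: le_lt_trans f2.
rewrite le_eqVlt; apply/orP; left; apply/eqP; apply: eq_integral => x _ /=.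
by congr EFin; rewrite powR_mulrn // real_normK ?num_real.
Qed.

Lemma fsum_ip1 (R : realType) (nu : (plane R -> R) -> (plane R -> R) ->
    {charge set (plane R) -> \bar R}) f g u v fC gC uF vF :
  fsum_ip nu [:: (exist _ f fC, exist _ u uF)] [:: (exist _ g gC, exist _ v vF)] =
  charge_integral (nu u v) (@gasket R) (fun x => f x * g x).
Proof. by rewrite /fsum_ip !big_seq1. Qed.

Section main.
Variable R : realType.
Local Notation K := (@gasket R).
Variable nu : (plane R -> R) -> (plane R -> R) -> {charge set (plane R) -> \bar R}.
Hypothesis hnu : forall u v, domF u -> domF v -> is_energy_measure u v (nu u v).
Variables (h : plane R -> R) (hharm : is_harmonic h).
Hypotheses (h0 : h (q R ord0) = 1) (h1 : h (q R 1) = 0) (h2 : h (q R 2) = 0).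
Variable nuh : {finite_measure set (plane R) -> \bar R}.
Hypothesis hnuh : forall A, measurable A -> nuh A = nu h h A.
Variables (uL uR : plane R -> R).

(* The gasket is set0 by definition if there is no attractor; treating this case
   is easier than proving Hutchinson's theorem. *)
Lemma dom_divergence_gasket0 : K = set0 ->
  dom_divergence nu (proj1 hharm) nuh (glue uL uR).
Proof.
move=> K0; have half0 i : half_gasket i = set0 :> set (plane R).
  by apply/seteqP; split=> // x [w _ []]; rewrite K0.
have -> : glue uL uR = cst 0.
  by apply/funext => x; rewrite /glue !half0 indic0 !mul0r addr0.
have cst0 : cst 0 \in Lfun nuh 2%:E.
  by apply: Lfun2P => //; rewrite /= expr0n integral0.
split=> //; exists (cst 0) => //; exists (fdu nu (@CK1 R) (proj1 hharm)).
have ip0 (a b : formal_sum R) : fsum_ip nu a b = 0.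
  rewrite /fsum_ip big1 // => s _; rewrite big1 // => t _.
  by rewrite /charge_integral K0 !Rintegral_set0 subrr.
have form0 (x y : one_form nu) : form_ip x y = 0.
  by rewrite /form_ip (_ : (fun n => _) = fun=> 0) ?lim_cst //; apply/funext => n; exact: ip0.
split=> [|phi phiF]; last by rewrite form0 K0 Rintegral_set0.
exists (fun=> fun=> 1), (fun=> @CK1 R); split.
  by rewrite K0; under eq_fun do rewrite integral_set0; exact: cvg_cst.
rewrite /form_dist2; under eq_fun do rewrite !form0 subrr subr0 addr0.
exact: cvg_cst.
Qed.

Hypothesis attr : is_attractor K.
Hypothesis uLD : half_dom 1 uL.
Hypothesis uRD : half_dom 2 uR.
Let u := glue uL uR.
Let f_ n := glue_cut uL uR n.
Let hF : domF h := proj1 hharm.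
Let hv := harmonic_vharmonic attr hharm.
Let mK := gasket_measurable attr.
Let fC n : CK (f_ n) := @glue_cut_CK R attr uL uR uLD uRD n.
Local Notation ip := (ip nuh K).
Local Notation bounded_on := (bounded_on K).

Lemma CK_bounded_on f : CK f -> bounded_on f.
Proof.
move=> cf; split; first exact: continuous_plane_measurable.
have cf0 : {within cell [::], continuous f} by rewrite cell_nil.
by have [M] := continuous_cell_bounded attr cf0; rewrite cell_nil => fM; exists M.
Qed.

Lemma glue_bounded_on : bounded_on u.
Proof.
have [M [_ uM _ _]] := glue_bounded attr uLD uRD.
by split; [exact: measurable_funS (glue_measurable attr uLD uRD)|exists M].
Qed.

Lemma nu_cell v w : domF v -> nu h v (cell w) = (cell_energy w h v)%:E.
Proof. by move=> vF; case: (hnu hF vF) => _; exact. Qed.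

Lemma nu_small v : domF v -> forall e : R, 0 < e -> exists m, forall w, (m <= size w)%N ->
  `|fine (nu h v (cell w))| <= e.
Proof. by move=> vF; apply: (energy_charge_small attr hv vF) => w; exact: nu_cell. Qed.

Lemma ipE f g : bounded_on f -> bounded_on g ->
  charge_integral (nu h h) K (fun x => f x * g x) = ip f g.
Proof.
move=> fb gb; have [m [M fgM]] := bounded_on_M fb gb.
exact: (charge_integral_measure hnuh mK m fgM).
Qed.

(** The approximation of u dh by formal sums: coefficients must be continuous, hence the cut
    functions. *)
Definition uform_ n : formal_sum R := [:: (exist _ (f_ n) (@fC n), exist _ h hF)].

Lemma f_bounded_on n : bounded_on (f_ n).
Proof. exact/CK_bounded_on/fC. Qed.

Lemma fsum_ipE f g (fK : CK f) (gK : CK g) :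
  fsum_ip nu [:: (exist _ f fK, exist _ h hF)] [:: (exist _ g gK, exist _ h hF)] = ip f g.
Proof. by rewrite fsum_ip1 ipE //; exact: CK_bounded_on. Qed.

Lemma cut_bounded_convergence v (F : nat -> plane R -> R) (G : plane R -> R) M : domF v ->
  (forall n, measurable_fun K (F n)) -> measurable_fun K G ->
  (forall x, K x -> ~ axis x -> F n x @[n --> \oo] --> G x) ->
  (forall n x, K x -> `|F n x| <= M) ->
  charge_integral (nu h v) K (F n) @[n --> \oo] --> charge_integral (nu h v) K G.
Proof.
move=> vF mF mG FG FM.
exact: (charge_integral_bounded_convergence attr (nu_small vF) mF mG
  (axis_measurable attr) (axis_null attr) FG FM).
Qed.

Lemma cut_dist_cvg : ip (fun x => 1 * f_ n x + -1 * u x) (fun x => 1 * f_ n x + -1 * u x)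
  @[n --> \oo] --> 0.
Proof.
have ub := glue_bounded_on.
have db n : bounded_on (fun x => 1 * f_ n x + -1 * u x).
  by apply: bounded_on_lin => //; exact: f_bounded_on.
have [M [M0 uM _ _]] := glue_bounded attr uLD uRD.
have := @cut_bounded_convergence h
  (fun n x => (1 * f_ n x + -1 * u x) * (1 * f_ n x + -1 * u x)) (cst 0) ((M + M) * (M + M)) hF.
have -> : charge_integral (nu h h) K (cst 0) = 0.
  by rewrite /charge_integral !Rintegral_cst // !mul0r subrr.
under [X in _ -> _ -> _ -> _ -> X @ _ --> _]eq_fun do rewrite ipE //.
apply.
- by move=> n; case: (bounded_on_M (db n) (db n)).
- exact: measurable_cst.
- move=> x Kx nx; have fx := glue_cut_cvg (uL := uL) (uR := uR) Kx nx.
  have d0 : 1 * f_ n x + -1 * u x @[n --> \oo] --> 1 * u x + -1 * u x.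
    by apply: cvgD; [apply: cvgMr; exact: fx|exact: cvg_cst].
  have -> : cst 0 x = (1 * u x + -1 * u x) * (1 * u x + -1 * u x) by rewrite /=; ring.
  by apply: cvgM; exact: d0.
- move=> n x Kx; rewrite normrM; apply: ler_pM => //;
  by apply: le_trans (ler_normD _ _) _; rewrite (normrM 1) (normrM (-1)) normrN normr1 !mul1r;
    apply: lerD; [apply: glue_cut_le|]; exact: uM.
Qed.

Lemma ip_sub f g : bounded_on f -> bounded_on g ->
  ip (fun x => 1 * f x + -1 * g x) (fun x => 1 * f x + -1 * g x) =
  ip f f - ip f g - ip g f + ip g g.
Proof.
move=> fb gb; rewrite ip_linl ?ip_linr //; last exact: bounded_on_lin.
ring.
Qed.

Lemma uform_cauchy : fsum_cauchy nu uform_.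
Proof.
move=> e e0; have /cvgrPdist_lt/(_ (e / 4)) := cut_dist_cvg.
case; first by rewrite divr_gt0.
move=> N _ Ne; exists N => m n Nm Nn; rewrite /fsum_dist2 !fsum_ipE.
have := Ne m Nm; have := Ne n Nn; rewrite /= !sub0r !normrN !ger0_norm ?ip_ge0 //.
have ub := glue_bounded_on; have mb := f_bounded_on m; have nb := f_bounded_on n.
have sb : bounded_on (fun x => 1 * f_ m x + 1 * f_ n x) by exact: bounded_on_lin.
(* The parallelogram law for a = f_m - u and b = f_n - u: |a - b|^2 = 2|a|^2 + 2|b|^2 - |a + b|^2.
   This explains the e/4. *)
have := ip_ge0 nuh K (fun x => 1 * (1 * f_ m x + 1 * f_ n x) + -2 * u x).
rewrite !ip_sub // ip_linl ?ip_linr //; try exact: bounded_on_lin.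
rewrite ?(ip_linl nuh mK) ?(ip_linr nuh mK) //.
rewrite (ipC nuh K u (f_ m)) (ipC nuh K u (f_ n)) (ipC nuh K (f_ n) (f_ m)).
lra.
Qed.

Definition uform : one_form nu := exist _ uform_ uform_cauchy.

Lemma cut_ip_cvg f : bounded_on f -> ip f (f_ n) @[n --> \oo] --> ip f u.
Proof.
move=> fb; have ub := glue_bounded_on; have [M [M0 uM _ _]] := glue_bounded attr uLD uRD.
have [mf [N fN]] := fb.
have := @cut_bounded_convergence h (fun n x => f x * f_ n x) (fun x => f x * u x) (N * M) hF.
rewrite ipE //; under [X in _ -> _ -> _ -> _ -> X @ _ --> _]eq_fun do
  rewrite (ipE fb (f_bounded_on _)).
apply.
- by move=> n; case: (bounded_on_M fb (f_bounded_on n)).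
- by case: (bounded_on_M fb ub).
- by move=> x Kx nx; apply: cvgMr; exact: glue_cut_cvg.
- move=> n x Kx; rewrite normrM; apply: ler_pM => //; first exact: fN.
  exact/glue_cut_le/uM.
Qed.

Lemma uform_mul_omega : is_mul_omega hF nuh u uform.
Proof.
exists f_, (@fC); have ub := glue_bounded_on; split.
  have E n : (\int[nuh]_(z in K) ((f_ n z - u z) ^+ 2)%:E =
      (ip (fun x => 1 * f_ n x + -1 * u x) (fun x => 1 * f_ n x + -1 * u x))%:E)%E.
    have db : bounded_on (fun x => 1 * f_ n x + -1 * u x).
      by apply: bounded_on_lin => //; exact: f_bounded_on.
    rewrite /ip /Rintegral fineK; last first.
      apply: (integrable_fin_num mK); exact: (bounded_on_integrable nuh mK (bounded_on_M db db)).
    by apply: eq_integral => x _; rewrite mul1r mulN1r expr2.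
  by under eq_fun do rewrite E; apply: cvg_EFin; [exact: nearW|exact: cut_dist_cvg].
have := cut_dist_cvg; apply: cvg_trans; apply: near_eq_cvg; apply: nearW => k.
rewrite ip_sub //; last exact: f_bounded_on.
rewrite /form_dist2; have fb := f_bounded_on k.
have E1 : form_ip (fdu nu (@fC k) hF) (fdu nu (@fC k) hF) = ip (f_ k) (f_ k) :> R.
  by rewrite /form_ip /= fsum_ipE lim_cst.
have E2 : form_ip (fdu nu (@fC k) hF) uform = ip (f_ k) u.
  rewrite /form_ip; apply: cvg_lim => //.
  by under eq_fun do rewrite /= fsum_ipE; exact: cut_ip_cvg.
have E3 : form_ip uform (fdu nu (@fC k) hF) = ip u (f_ k).
  rewrite /form_ip; apply: cvg_lim => //; rewrite ipC.
  by under eq_fun do rewrite /= fsum_ipE ipC; exact: cut_ip_cvg.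
have E4 : form_ip uform uform = ip u u.
  rewrite /form_ip; apply: cvg_lim => //.
  under eq_fun do rewrite /= fsum_ipE.
  have [M [M0 uM _ _]] := glue_bounded attr uLD uRD.
  have := @cut_bounded_convergence h (fun n x => f_ n x * f_ n x) (fun x => u x * u x) (M * M) hF.
  rewrite ipE //; under [X in _ -> _ -> _ -> _ -> X @ _ --> _]eq_fun do
    rewrite (ipE (f_bounded_on _) (f_bounded_on _)).
  apply.
  - by move=> n; case: (bounded_on_M (f_bounded_on n) (f_bounded_on n)).
  - by case: (bounded_on_M ub ub).
  - by move=> x Kx nx; apply: cvgM; exact: glue_cut_cvg.
  - by move=> n x Kx; rewrite normrM; apply: ler_pM => //; exact/glue_cut_le/uM.
by rewrite E1 E2 E3 E4.
Qed.

Lemma charge_cut_cvg v : domF v ->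
  charge_integral (nu h v) K (f_ n) @[n --> \oo] --> charge_integral (nu h v) K u.
Proof.
move=> vF; have [M [M0 uM _ _]] := glue_bounded attr uLD uRD.
apply: (@cut_bounded_convergence v f_ u M vF).
- by move=> n; case: (f_bounded_on n).
- by case: glue_bounded_on.
- by move=> x Kx nx; exact: glue_cut_cvg.
- by move=> n x _; exact/glue_cut_le/uM.
Qed.

Lemma uform_ip phi (phiF : domF phi) :
  form_ip uform (du nu phiF) = charge_integral (nu h phi) K u.
Proof.
rewrite /form_ip; apply: cvg_lim => //.
have E n : fsum_ip nu (sval uform n) (sval (du nu phiF) n) =
    charge_integral (nu h phi) K (f_ n).
  by rewrite /= fsum_ip1; congr charge_integral; apply/funext => x; rewrite mulr1.
by under eq_fun do rewrite E; exact: charge_cut_cvg.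
Qed.

(** The energy charges are used only through their values on cells, so linearity in the test
    function is read off the Riemann sums. That works for the continuous cut functions and passes to
    [u] by bounded convergence. *)
Lemma charge_integral_lin r s f g : domF f -> domF g ->
  charge_integral (nu h (fun x => r * f x + s * g x)) K u =
  r * charge_integral (nu h f) K u + s * charge_integral (nu h g) K u.
Proof.
move=> fF gF; have rsF := domF_lin attr r s fF gF.
rewrite -(cvg_lim (@Rhausdorff R) (charge_cut_cvg rsF)); apply: cvg_lim => //.
have E n : charge_integral (nu h (fun x => r * f x + s * g x)) K (f_ n) =
    r * charge_integral (nu h f) K (f_ n) + s * charge_integral (nu h g) K (f_ n).
  have cf : {within cell [::], continuous (f_ n)} by rewrite cell_nil; exact: fC.
  have RC v (vF : domF v) := Riemann_sum_cvg attr hv hF vF (fun w => nu_cell w vF) cf.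
  rewrite -cell_nil -(cvg_lim (@Rhausdorff R) (RC _ rsF)); apply: cvg_lim => //.
  have -> : Riemann_sum h (fun x => r * f x + s * g x) [::] (f_ n) =
      (fun m => r * Riemann_sum h f [::] (f_ n) m + s * Riemann_sum h g [::] (f_ n) m).
    apply/funext => m; rewrite /Riemann_sum !(mulrCA _ (_ ^- _)) -mulrDr; congr (_ * _).
    rewrite !mulr_sumr -big_split; apply: eq_bigr => v _.
    by rewrite /Et /vals /=; ring.
  by apply: cvgD; apply: cvgMr; exact: RC.
rewrite (funext E); apply: cvgD; apply: cvgMr; exact: charge_cut_cvg.
Qed.

Lemma dom_divergence_glue : dom_divergence nu hF nuh u.
Proof.
have [M [M0 uM _ _]] := glue_bounded attr uLD uRD.
have mu : measurable_fun setT u := glue_measurable attr uLD uRD.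
split.
  apply: Lfun2P => //.
  have u2M x : setT x -> `|u x ^+ 2| <= M ^+ 2.
    by move=> _; rewrite normrX lerXn2r ?nnegrE.
  have u2 := bounded_integrable nuh measurableT (measurable_funX 2 mu) u2M.
  by have := integrable_fin_num measurableT u2; rewrite fin_numElt => /andP[].
have ell_le f : domF0 f -> 2 * `|charge_integral (nu h f) K u| <=
    ip f f + (half_energy 1 uL + half_energy 2 uR).
  move=> fF; exact: (divergence_bound attr hharm h0 h1 h2 fF
    (fun w => nu_cell w fF.1) (fun w => nu_cell w hF) hnuh uLD uRD).
have domF0_0 : [set f : plane R -> R | domF0 f] !=set0.
  exists (fun x => 0 * h x + 0 * h x); split; first exact: domF_lin.
  by move=> p _; rewrite !mul0r addr0.
have [g [mg g0 g2 gE]] := @representation _ _ _ nuh K mK (@domF0 R)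
  (fun f => charge_integral (nu h f) K u) _ domF0_0
  (fun f fF => CK_bounded_on fF.1.1) (fun r s f g => @domF0_lin R attr r s f g)
  (fun r s f g fF gF => charge_integral_lin r s fF.1 gF.1) ell_le.
exists g.
  apply: Lfun2P => //; apply: le_lt_trans g2; rewrite le_eqVlt; apply/orP; left.
  (* Membership in L^2 refers to the whole plane; since g vanishes off the gasket, the integral of
     its square over the gasket suffices. *)
  rewrite [eqbRHS]integral_mkcond; apply/eqP; apply: eq_integral => x _; rewrite /patch.
  case: (boolP (x \in K)) => // /negP xK.
  by rewrite g0 ?expr0n // => Kx; apply: xK; exact: mem_set.
exists uform; split; first exact: uform_mul_omega.
by move=> phi phiF; rewrite uform_ip gE.
Qed.

End main.

Theorem proposition10p1 (R : realType)
  (nu : (plane R -> R) -> (plane R -> R) -> {charge set (plane R) -> \bar R})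
  (hnu : forall u v, domF u -> domF v -> is_energy_measure u v (nu u v))
  (h : plane R -> R) (hharm : is_harmonic h)
  (h0 : h (q R ord0) = 1) (h1 : h (q R 1) = 0) (h2 : h (q R 2) = 0)
  (nuh : {finite_measure set (plane R) -> \bar R})
  (hnuh : forall A, measurable A -> nuh A = nu h h A)
  (uL uR : plane R -> R) (huL : half_dom 1 uL) (huR : half_dom 2 uR) :
  dom_divergence nu (proj1 hharm) nuh
    (fun x => \1_(half_gasket 1) x * uL x + \1_(half_gasket 2) x * uR x).
Proof.
have [attr|K0] : is_attractor (@gasket R) \/ @gasket R = set0.
- have [[A attr]|noA] := pselect (exists A, @is_attractor R A).
    by left; apply: xgetPex; exists A.
  by right; apply: xgetPN => A attr; apply: noA; exists A.
- exact: (dom_divergence_glue hnu hharm h0 h1 h2 hnuh attr huL huR).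
- exact: (dom_divergence_gasket0 nu hharm nuh uL uR K0).
Qed.
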